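(* Let $m\ge2$, let $\rho:[0,1]\to[0,1]$ be continuous and nondecreasing with $x\in(0,1]\mapsto\rho(x)/x$ nondecreasing, and let $t_k=\rho(k/m)$. Let $\zeta\in(0,1)$, $\lambda\in\{1,\dots,m\}$ and $\delta\in(0,1)$. Define $G^{DU}_\zeta(x)=(1-\zeta)+\zeta x$, $$u^+_\delta=\mathcal{U}\big(\lambda/m,(G^{DU}_\zeta+\delta)\wedge 1\big),\qquad u^-_\delta=\mathcal{U}\big(\lambda/m,(G^{DU}_\zeta-\delta)\vee 0\big),$$ and for $y\in(0,1)$, $$\varepsilon(\delta,m,\zeta,y)=\frac{\rho(u^+_\delta)-\rho(u^-_\delta)}{u^+_\delta}+\frac{4}{1-\zeta}\exp\Big(-2m\big(\delta-y-\tfrac1m\big)_+^2\,(1-y/\zeta)_+\Big).$$ Then for every $F\in\mathcal F$: (i) in the fixed mixture model with $0<m_0<m$, setting $\nu=\max_{k\in\{m_0-1,m_0\}}|k/m-\zeta|$, $$\mathrm{FDR}(\mathrm{SUD}_\lambda(\mathbf t),\mathrm{FM}(m,m_0,F))\le \mathrm{FDR}(\mathrm{SUD}_\lambda(\mathbf t),\mathrm{FM}(m,m_0,F\equiv1))+\frac{m_0}{m}\,\varepsilon(\delta,m,\zeta,\nu);$$ (ii) in the random mixture model with $\pi_0=\zeta$, for every $\gamma\in(0,1)$, $$\mathrm{FDR}(\mathrm{SUD}_\lambda(\mathbf t),\mathrm{RM}(m,\pi_0,F))\le \mathrm{FDR}(\mathrm{SUD}_\lambda(\mathbf t),\mathr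m{RM}(m,\pi_0,F\equiv1))+\pi_0\,\varepsilon(\delta,m,\zeta,\gamma)+4e^{-2m(\gamma-1/m)_+^2}.$$
   Context: $\mathcal F$ is the set of continuous c.d.f.'s from $[0,1]$ to $[0,1]$. Fixed mixture model $\mathrm{FM}(m,m_0,F)$: $p_1,\dots,p_m$ are mutually independent, $p_i\sim U(0,1)$ for $1\le i\le m_0$ (true nulls), $p_i\sim F$ for $m_0<i\le m$. Random mixture model $\mathrm{RM}(m,\pi_0,F)$: $m_0\sim\mathrm{Binomial}(m,\pi_0)$ is unobserved and, conditionally on $m_0$, $\mathbf p\sim\mathrm{FM}(m,m_0,F)$. The case $F\equiv1$ (Dirac-uniform configuration) means the alternative $p$-values equal $0$ almost surely. Step-up-down procedure $\mathrm{SUD}_\lambda(\mathbf t)$ for a nondecreasing threshold collection $\mathbf t=(t_k)_{1\le k\le m}\subset[0,1]$, $t_0=0$: with $p_{(1)}\le\dots\le p_{(m)}$, $p_{(0)}=0$, let $\hat k=\max\{k\in\{\lambda,\dots,m\}: \forall k'\in\{\lambda,\dots,k\},\ p_{(k')}\le t_{k'}\}$ if $p_{(\lambda)}\le t_\lambda$, and $\hat k=\max\{k\in\{0,\dots,\lambda\}: p_{(k)}\le t_k\}$ otherwise; it rejects hypothesis $i$ iff $p_i\le t_{\hat k}$. FDR: $\mathrm{FDR}(\mathrm{SUD}_\lambda(\mathbf t),P)=\mathbb E_{\mathbf p\sim P}\Big[\frac{|\{1\le i\le m_0: p_i\le t_{\hat k}\}|}{|\{1\le i\le m: p_i\le t_{\hat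 k}\}|\vee1}\Big]$, where $m_0$ is random under RM and the expectation is also over $m_0$. For nondecreasing $G:[0,1]\to[0,1]$ and $\tau\in[0,1]$: $\mathcal{U}(\tau,G)=\min\{u\in[\tau,1]: G(\rho(u))\le u\}$ if $G(\rho(\tau))\ge\tau$, and $\mathcal{U}(\tau,G)=\max\{u\in[0,\tau]: G(\rho(u))\ge u\}$ if $G(\rho(\tau))<\tau$. *)

(* Defs.v *)
From HB Require Import structures.
From mathcomp Require Import all_boot all_order all_algebra.
From mathcomp Require Import all_classical all_reals all_analysis.
Set Implicit Arguments. Unset Strict Implicit. Unset Printing Implicit Defensive.
Import Order.TTheory GRing.Theory Num.Theory.
Import numFieldNormedType.Exports.
Local Open Scope classical_set_scope.
Local Open Scope ring_scope.

Section Defs.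
Context {R : realType}.

Definition order_stat (m : nat) (p : 'I_m -> R) (k : nat) : R :=
  if k is k'.+1 then nth 0 (sort <=%R [seq p i | i <- enum 'I_m]) k' else 0.

Definition sud_khat (m lam : nat) (t : nat -> R) (p : 'I_m -> R) : nat :=
  let ps := order_stat p in
  if ps lam <= t lam then
    \big[maxn/0%N]_(k < m.+1 | (lam <= k)%N &&
        [forall k' : 'I_m.+1, ((lam <= k') && (k' <= k))%N ==> (ps k' <= t k')%R])
      (nat_of_ord k)
  else \big[maxn/0%N]_(k < m.+1 | (k <= lam)%N && (ps k <= t k)%R) (nat_of_ord k).

(* false discovery proportion of SUD_lambda(t) when the first m0 hypotheses are null *)
Definition fdp (m m0 lam : nat) (t : nat -> R) (p : 'I_m -> R) : R :=
  let th := t (sud_khat lam t p) in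
  let V := (\sum_(i < m | (i < m0)%N && (p i <= th)%R) 1)%N in
  let Rn := (\sum_(i < m | (p i <= th)%R) 1)%N in
  V%:R / (maxn Rn 1)%:R.

Definition thr (rho : R -> R) (m : nat) (k : nat) : R :=
  if k is 0 then 0 else rho (k%:R / m%:R).

(* extension to the real line of a c.d.f. given on [0,1] of a [0,1]-valued variable *)
Definition cdf01 (F : R -> R) (x : R) : R :=
  if x < 0 then 0 else if x <= 1 then F x else 1.

Definition in_calF (F : R -> R) : Prop :=
  {within [set x | 0 <= x <= 1], continuous F} /\
  (forall x, 0 <= x <= 1 -> 0 <= F x <= 1) /\
  (forall x y, 0 <= x -> x <= y -> y <= 1 -> F x <= F y) /\
  F 1 = 1.

Definition fm_cdf (m0 : nat) (F : R -> R) (m : nat) (i : 'I_m) (y : R) : R :=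
  if (i < m0)%N then cdf01 id y else cdf01 F y.

(* p = (p_i)_i on (T,P) has law FM(m,m0,F): joint c.d.f. is the product of
   the marginal c.d.f.'s (mutual independence + marginals) *)
Definition is_FM d (T : measurableType d) (P : probability T R) (m m0 : nat)
    (F : R -> R) (p : 'I_m -> T -> R) : Prop :=
  (forall i, measurable_fun setT (p i)) /\
  forall x : 'I_m -> R,
    P [set w | forall i, p i w <= x i] = (\prod_(i < m) fm_cdf m0 F i (x i))%:E.

(* (M0, p) on (T,P) has law RM(m,pi0,F): M0 ~ Binomial(m,pi0) and,
   conditionally on M0 = k, p ~ FM(m,k,F) *)
Definition is_RM d (T : measurableType d) (P : probability T R) (m : nat)
    (pi0 : R) (F : R -> R) (M0 : T -> nat) (p : 'I_m -> T -> R) : Prop :=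
  (forall i, measurable_fun setT (p i)) /\
  (forall k, measurable [set w | M0 w = k]) /\
  forall (k : nat) (x : 'I_m -> R),
    P [set w | M0 w = k /\ forall i, p i w <= x i] =
    ('C(m, k)%:R * pi0 ^+ k * (1 - pi0) ^+ (m - k) *
       \prod_(i < m) fm_cdf k F i (x i))%:E.

Definition FDR_FM d (T : measurableType d) (P : probability T R) (m m0 lam : nat)
    (t : nat -> R) (p : 'I_m -> T -> R) : \bar R :=
  (\int[P]_w (fdp m0 lam t (fun i => p i w))%:E)%E.

Definition FDR_RM d (T : measurableType d) (P : probability T R) (m lam : nat)
    (t : nat -> R) (M0 : T -> nat) (p : 'I_m -> T -> R) : \bar R :=
  (\int[P]_w (fdp (M0 w) lam t (fun i => p i w))%:E)%E.

(* \mathcal U(tau, G) (min / max realized as inf / sup) *)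
Definition Ucal (rho : R -> R) (tau : R) (G : R -> R) : R :=
  if tau <= G (rho tau) then inf [set u | tau <= u <= 1 /\ G (rho u) <= u]
  else sup [set u | 0 <= u <= tau /\ u <= G (rho u)].

Definition GDU (zeta : R) (x : R) : R := (1 - zeta) + zeta * x.

Definition eps_bound (rho : R -> R) (m lam : nat) (zeta delta y : R) : R :=
  let tau := lam%:R / m%:R in
  let up := Ucal rho tau (fun x => Num.min (GDU zeta x + delta) 1) in
  let um := Ucal rho tau (fun x => Num.max (GDU zeta x - delta) 0) in
  (rho up - rho um) / up +
  4 / (1 - zeta) * expR (- (2 * m%:R) * (Num.max 0 (delta - y - 1 / m%:R)) ^+ 2
                          * Num.max 0 (1 - y / zeta)).

End Defs.

(* Main.v *)
(**
Only the comparisons of the p-values with the thresholds matter, so each p-value is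
replaced by the index of its cell between consecutive thresholds and both models become
finite product measures.  For a null i let K0 and K1 be the values of khat when p_i is
moved to the first and to the last cell.  If i is rejected then khat = K0, hence its
contribution to the FDR is at most E[t_K0 / K0]; since t_k / k is nondecreasing this is
largest for the Dirac-uniform configuration, under which the contribution is at least
E[t_K1 / K0].  It remains to bound E[(t_K0 - t_K1) / K0], and u^- <= K1/m <= K0/m <= u^+
fails only if the empirical process of the other nulls deviates by
m (delta - nu - 1/m).  In the step-down direction for u^+ and the step-up direction for
u^- the deviation occurs at one fixed threshold and Hoeffding's inequality applies.
Otherwise it occurs at a random threshold; the martingale (N_k - n T_k) / (1 - T_k) and
Doob's inequality on blocks where 1 - T varies by a factor sqrt zeta (on T <= 1/2, and by
reflection on T >= 1/2) give 2J exp(-zeta E) with zeta^J <= 1/4, and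
2J + 1 <= 4 / (1 - zeta).  The random model follows by averaging over m_0 and
Hoeffding's inequality for the binomial law.
*)
Require Import Defs.
From HB Require Import structures.
From mathcomp Require Import all_boot all_order all_algebra.
From mathcomp Require Import zify ring lra.
From mathcomp Require Import all_classical all_reals all_analysis.
From mathcomp Require Import measurable_realfun.
Set Implicit Arguments. Unset Strict Implicit. Unset Printing Implicit Defensive.
Import Order.TTheory GRing.Theory Num.Theory.
Import numFieldNormedType.Exports.
Local Open Scope classical_set_scope.
Local Open Scope ring_scope.

Section Hoeffding.
Context {R : realType}.

Lemma mvt_is_derive (f df : R -> R) (x y : R) :
  (forall z : R, is_derive z (1 : R) f (df z)) -> x <= y ->
  exists2 c, x <= c <= y & f y - f x = df c * (y - x).
Proof.
move=> fd xy.
have fc : {within `[x, y], continuous f}.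
  apply: continuous_subspaceT => z.
  apply/differentiable_continuous/derivable1_diffP.
  by have [] := fd z.
have [c cxy e] := MVT_segment xy (fun z _ => fd z) fc.
by exists c => //; move: cxy; rewrite in_itv.
Qed.

Lemma hoeffding_lemma (p s : R) : 0 <= p <= 1 ->
  p * expR (s * (1 - p)) + (1 - p) * expR (s * (0 - p)) <= expR (s ^+ 2 / 8).
Proof.
move=> /andP[p0 p1].
pose D z := 1 - p + p * expR z.
have D0 z : 0 < D z.
  rewrite /D; have := expR_gt0 z; have [->|pn1] := eqVneq p 1; first by lra.
  have : p < 1 by rewrite lt_neqAle pn1.
  move=> ? e0; rewrite ltr_pwDl ?subr_gt0// mulr_ge0//; exact: ltW.
pose q z := 1 - (1 - p) * (D z)^-1.
pose df z := z / 4 + p - q z.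
pose f z := z ^+ 2 / 8 + p * z - ln (D z).
have Dd z : is_derive z (1:R) D (p * expR z).
  rewrite /D; apply: is_derive_eq.
  by rewrite /GRing.scale/=; ring.
have dfd z : is_derive z (1:R) df (4^-1 - q z * (1 - q z)).
  have Dn : D z != 0 by rewrite gt_eqF.
  have iD : is_derive z (1:R) (fun z => (D z)^-1) (- (D z) ^- 2 *: (p * expR z)).
    exact: is_deriveV.
  rewrite /df /q; apply: is_derive_eq.
  rewrite /GRing.scale/= /q.
  have -> : p * expR z = D z - (1 - p) by rewrite /D; ring.
  field; exact: Dn.
have fd z : is_derive z (1:R) f (df z).
  have Dn : D z != 0 by rewrite gt_eqF.
  have lD : is_derive z (1:R) (fun z => ln (D z)) ((D z)^-1 * (p * expR z)).
    by have h := is_derive1_ln (D0 z); apply: is_derive1_comp.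
  rewrite /f; apply: is_derive_eq.
  rewrite /GRing.scale/= /df /q.
  have -> : p * expR z = D z - (1 - p) by rewrite /D; ring.
  field; exact: Dn.
have df0 : df 0 = 0 by rewrite /df /q /D expR0; field; rewrite subrK oner_neq0.
have ddf0 z : 0 <= 4^-1 - q z * (1 - q z).
  have -> : 4^-1 - q z * (1 - q z) = (q z - 2^-1) ^+ 2 by field.
  exact: sqr_ge0.
have f0 : f 0 = 0 by rewrite /f /D expR0 mulr1 subrK ln1; ring.
have dfnd x y : x <= y -> df x <= df y.
  move=> xy; have [c _ e] := @mvt_is_derive df (fun z => 4^-1 - q z * (1 - q z)) x y dfd xy.
  by rewrite -subr_ge0 e mulr_ge0 ?ddf0// subr_ge0.
have fs : 0 <= f s.
  have [s0|/ltW s0] := leP 0 s; have [c /andP[c0 c1] e] := @mvt_is_derive f df _ _ fd s0.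
    by move: e; rewrite f0 !subr0 => ->; apply: mulr_ge0 => //; rewrite -df0 dfnd.
  have : f 0 - f s <= 0.
    by rewrite e sub0r; apply: mulr_le0_ge0; rewrite ?oppr_ge0// -df0 dfnd.
  by rewrite f0 sub0r oppr_le0.
have -> : p * expR (s * (1 - p)) + (1 - p) * expR (s * (0 - p)) = expR (ln (D s) - p * s).
  rewrite expRD lnK ?posrE// /D.
  have -> : s * (1 - p) = s + - (p * s) by ring.
  have -> : s * (0 - p) = - (p * s) by ring.
  by rewrite expRD; ring.
by rewrite ler_expR; move: fs; rewrite /f; lra.
Qed.

End Hoeffding.

(** * Finite product expectations *)

Section ProductExpectation.
Context {R : realType} {I J : finType}.
Implicit Types (w : I -> J -> R) (f g : {ffun I -> J} -> R) (c : {ffun I -> J}).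

Definition is_pmf (u : J -> R) := (forall a, 0 <= u a) /\ \sum_a u a = 1.

Definition Ex w f : R := \sum_(c : {ffun I -> J}) (\prod_i w i (c i)) * f c.

Definition upd c (j : I) (a : J) : {ffun I -> J} :=
  [ffun i => if i == j then a else c i].

Lemma Ex_le w f g : (forall i a, 0 <= w i a) ->
  (forall c, (forall i, w i (c i) != 0) -> f c <= g c) -> Ex w f <= Ex w g.
Proof.
move=> w0 fg; apply: ler_sum => c _.
have [/existsP[i /eqP wi]|/existsPn wn] := boolP [exists i, w i (c i) == 0].
  by rewrite (bigD1 i)//= wi !mul0r.
by apply: ler_wpM2l; [apply: prodr_ge0|apply: fg].
Qed.

Lemma ExD w f g : Ex w (fun c => f c + g c) = Ex w f + Ex w g.
Proof. by rewrite -big_split/=; apply: eq_bigr => c _; rewrite mulrDr. Qed.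

Lemma ExZ w f (x : R) : Ex w (fun c => x * f c) = x * Ex w f.
Proof. by rewrite mulr_sumr; apply: eq_bigr => c _; rewrite mulrCA. Qed.

Lemma Ex_sum w (K : Type) (r : seq K) (P : pred K) (F : K -> {ffun I -> J} -> R) :
  Ex w (fun c => \sum_(k <- r | P k) F k c) = \sum_(k <- r | P k) Ex w (F k).
Proof.
rewrite /Ex exchange_big/=; apply: eq_bigr => c _; exact: mulr_sumr.
Qed.

Lemma Ex_eq w f g : (forall c, f c = g c) -> Ex w f = Ex w g.
Proof. by move=> fg; apply: eq_bigr => c _; rewrite fg. Qed.

Lemma Ex_prod w (g : I -> J -> R) :
  Ex w (fun c => \prod_i g i (c i)) = \prod_i \sum_a w i a * g i a.
Proof.
by rewrite bigA_distr_bigA; apply: eq_bigr => c _; rewrite -big_split.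
Qed.

Lemma Ex_cst w (x : R) : (forall i, is_pmf (w i)) -> Ex w (fun=> x) = x.
Proof.
move=> w1; rewrite -[RHS]mulr1 -[in LHS](mulr1 x) ExZ; congr (_ * _).
have -> : Ex w (fun=> 1) = Ex w (fun c => \prod_i (fun _ _ => 1) i (c i)).
  by apply: Ex_eq => c; rewrite big1.
rewrite (Ex_prod w (fun _ _ => 1)) big1// => i _; under eq_bigr do rewrite mulr1.
by case: (w1 i).
Qed.

(* Reindexing along the involution (c, a) |-> (c[j := a], c j). *)
Lemma Ex_resample w (j : I) (v : J -> R) f : \sum_a w j a = 1 ->
  Ex w (fun c => \sum_a v a * f (upd c j a)) =
  Ex (fun i => if i == j then v else w i) f.
Proof.
move=> w1.
transitivity (\sum_(x : {ffun I -> J} * J)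
    (\prod_i w i (x.1 i)) * (v x.2 * f (upd x.1 j x.2))).
  rewrite -(pair_bigA _ (fun (c : {ffun I -> J}) a =>
    (\prod_i w i (c i)) * (v a * f (upd c j a))))/=.
  by apply: eq_bigr => c _; exact: mulr_sumr.
pose phi (x : {ffun I -> J} * J) := (upd x.1 j x.2, x.1 j).
have phiK : involutive phi.
  move=> [c a]; rewrite /phi/=; congr pair; last by rewrite ffunE eqxx.
  by apply/ffunP => i; rewrite !ffunE; case: eqVneq => // ->.
rewrite (reindex_inj (inv_inj phiK))/=.
have wE x : (\prod_i w i ((phi x).1 i)) * (v (phi x).2 * f (upd (phi x).1 j (phi x).2))
   = (\prod_i (if i == j then v else w i) (x.1 i)) * f x.1 * w j x.2.
  have -> : upd (phi x).1 j (phi x).2 = x.1.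
    by apply/ffunP => i; rewrite !ffunE; case: eqVneq => // ->.
  rewrite (bigD1 j)//= [in RHS](bigD1 j)//= eqxx ffunE eqxx.
  have -> : \prod_(i | i != j) w i (upd x.1 j x.2 i) =
            \prod_(i | i != j) (if i == j then v else w i) (x.1 i).
    by apply: eq_bigr => i /negbTE ij; rewrite ffunE ij.
  by ring.
under eq_bigr do rewrite wE.
rewrite -(pair_bigA _ (fun (c : {ffun I -> J}) a =>
  (\prod_i (if i == j then v else w i) (c i)) * f c * w j a))/=.
by apply: eq_bigr => c _; rewrite -mulr_sumr w1 mulr1.
Qed.

Lemma Ex_resample_id w (j : I) f : \sum_a w j a = 1 ->
  Ex w (fun c => \sum_a w j a * f (upd c j a)) = Ex w f.
Proof.
move=> w1; rewrite Ex_resample//; apply: eq_bigr => c _; congr (_ * _).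
by apply: eq_bigr => i _; case: eqVneq => // ->.
Qed.

Lemma Ex_trunc (tau : J -> J) w f (g : I -> J -> R) :
  Ex w (fun c => f [ffun i => tau (c i)] * \prod_i g i (c i)) =
  \sum_v f v * \prod_i \sum_(a | tau a == v i) w i a * g i a.
Proof.
rewrite /Ex (partition_big (fun c => [ffun i => tau (c i)]) xpredT)//=.
apply: eq_bigr => v _; rewrite bigA_distr_big_dep/= mulr_sumr.
apply: eq_big => [c|c /eqP ->].
  apply/eqP/familyP => [<- i|h]; first by rewrite ffunE; exact: eqxx.
  by apply/ffunP => i; rewrite ffunE; exact/eqP/h.
by rewrite big_split/=; ring.
Qed.

Lemma Ex_trunc_le (tau : J -> J) w f (g h : I -> J -> R) :
  (forall c, 0 <= f c) -> (forall i a, 0 <= w i a * h i a) ->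
  (forall i v, \sum_(a | tau a == v) w i a * h i a <=
               \sum_(a | tau a == v) w i a * g i a) ->
  Ex w (fun c => f [ffun i => tau (c i)] * \prod_i h i (c i)) <=
  Ex w (fun c => f [ffun i => tau (c i)] * \prod_i g i (c i)).
Proof.
move=> f0 h0 hg; rewrite (Ex_trunc tau w f h) (Ex_trunc tau w f g); apply: ler_sum => v _.
apply: ler_wpM2l => //; apply: ler_prod => i _; rewrite hg andbT.
exact: sumr_ge0.
Qed.

End ProductExpectation.

(** * A maximal inequality for the uniform empirical process *)

Section Deviations.
Context {R : realType} {I : finType} {M : nat}.
Implicit Types (w : I -> 'I_M.+1 -> R) (u : 'I_M.+1 -> R) (D : {set I}).
Implicit Types (c : {ffun I -> 'I_M.+1}).

Definition cumul u (k : nat) : R := \sum_(a : 'I_M.+1 | (a < k)%N) u a.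

Definition dev D u (k : nat) c : R :=
  \sum_(i in D) (((c i < k)%N)%:R - cumul u k).

Lemma cumulC u k : is_pmf u -> \sum_(a : 'I_M.+1 | ~~ (a < k)%N) u a = 1 - cumul u k.
Proof.
case=> _ u1; rewrite -u1 [X in _ = X - _](bigID (fun a : 'I_M.+1 => (a < k)%N))/=.
by rewrite addrAC subrr add0r.
Qed.

Lemma cumul_ge0 u k : is_pmf u -> 0 <= cumul u k.
Proof. by case=> u0 _; apply: sumr_ge0. Qed.

Lemma cumul_le1 u k : is_pmf u -> cumul u k <= 1.
Proof.
by move=> uP; rewrite -subr_ge0 -cumulC//; case: uP => u0 _; apply: sumr_ge0.
Qed.

Lemma expR_dev D u k c (s : R) : expR (s * dev D u k c) =
  \prod_i (if i \in D then expR (s * ((c i < k)%N%:R - cumul u k)) else 1).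
Proof. by rewrite -big_mkcond/= -expR_sum mulr_sumr. Qed.

Lemma mgf_dev w u D k (s : R) : (forall i, is_pmf (w i)) -> is_pmf u ->
  (forall i, i \in D -> w i = u) ->
  Ex w (fun c => expR (s * dev D u k c)) <= expR (#|D|%:R * (s ^+ 2 / 8)).
Proof.
move=> wP uP wD.
pose g i (a : 'I_M.+1) : R :=
  if i \in D then expR (s * ((a < k)%N%:R - cumul u k)) else 1.
rewrite (Ex_eq _ (g := fun c => \prod_i g i (c i))); last by move=> c; rewrite expR_dev.
rewrite Ex_prod.
apply: (@le_trans _ _ (\prod_i (if i \in D then expR (s ^+ 2 / 8) else 1))).
  apply: ler_prod => i _; apply/andP; split.
    apply: sumr_ge0 => a _; apply: mulr_ge0; first by case: (wP i).
    by rewrite /g; case: ifP => // _; exact: expR_ge0.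
  rewrite /g; case: ifPn => iD; last first.
    by under eq_bigr do rewrite mulr1; case: (wP i) => _ ->.
  rewrite (wD _ iD) (bigID (fun a : 'I_M.+1 => (a < k)%N))/=.
  rewrite (eq_bigr (fun a => u a * expR (s * (1 - cumul u k)))); last first.
    by move=> a ->.
  rewrite [X in _ + X](eq_bigr (fun a => u a * expR (s * (0 - cumul u k)))); last first.
    by move=> a /negbTE ->.
  rewrite -!mulr_suml cumulC//; apply: hoeffding_lemma.
  by rewrite cumul_ge0// cumul_le1.
by rewrite -big_mkcond/= prodr_const -expRM_natl mulr_natl.
Qed.

Lemma dev_tail w u D (k : nat) (sg b v : R) : (forall i, is_pmf (w i)) -> is_pmf u ->
  (forall i, i \in D -> w i = u) -> sg ^+ 2 = 1 -> 0 <= b -> 0 < v ->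
  #|D|%:R <= v ->
  Ex w (fun c => ((b <= sg * dev D u k c)%R)%:R) <= expR (- (2 * b ^+ 2 / v)).
Proof.
move=> wP uP wD sg1 b0 v0 Dv.
pose s := 4 * b / v.
have s0 : 0 <= s by rewrite /s divr_ge0// ?mulr_ge0// ltW.
apply: (@le_trans _ _ (expR (- (s * b)) * Ex w (fun c => expR (s * sg * dev D u k c)))).
  rewrite -ExZ; apply: Ex_le => [i a|c _]; first by case: (wP i).
  rewrite -expRD; case: (boolP (b <= _)) => h /=; last exact: expR_ge0.
  rewrite -expR0 ler_expR -mulrA addrC -mulrBr mulr_ge0// subr_ge0.
  exact: h.
apply: le_trans (_ : expR (- (s * b)) * expR (v * (s ^+ 2 / 8)) <= _).
  rewrite ler_wpM2l ?expR_ge0//; apply: le_trans (mgf_dev _ _ wP uP wD) _.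
  by rewrite ler_expR exprMn sg1 mulr1 ler_wpM2r// divr_ge0 ?sqr_ge0.
rewrite -expRD ler_expR le_eqVlt; apply/orP; left; apply/eqP.
by rewrite /s; field; rewrite gt_eqF.
Qed.

Definition capo (k : 'I_M.+1) (a : 'I_M.+1) : 'I_M.+1 := if (a < k)%N then a else k.

Lemma capo_lt (k a : 'I_M.+1) (j : nat) : (j <= k)%N -> (capo k a < j)%N = (a < j)%N.
Proof. by rewrite /capo; case: (ltnP a k) => // ka jk; rewrite !ltnNge jk (leq_trans jk ka). Qed.

Lemma dev_capo D u (k : 'I_M.+1) (j : nat) c : (j <= k)%N ->
  dev D u j [ffun i => capo k (c i)] = dev D u j c.
Proof. by move=> jk; apply: eq_bigr => i _; rewrite ffunE capo_lt. Qed.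

(* Conditional Jensen inequality for the martingale (N_k - n T_k) / (1 - T_k). *)
Lemma dev_submart w u D (k k1 : 'I_M.+1) (s : R) (f : {ffun I -> 'I_M.+1} -> R) :
  (forall i, is_pmf (w i)) -> is_pmf u -> (forall i, i \in D -> w i = u) ->
  (k <= k1)%N -> cumul u k < 1 -> (forall c, 0 <= f c) ->
  (forall c, f [ffun i => capo k (c i)] = f c) ->
  Ex w (fun c => f c * expR (s * ((1 - cumul u k1) / (1 - cumul u k)) * dev D u k c)) <=
  Ex w (fun c => f c * expR (s * dev D u k1 c)).
Proof.
move=> wP uP wD kk1 Tk f0 fk.
set T1 := cumul u k1; set T := cumul u k; rewrite -/T in Tk.
have W0 : 0 < 1 - T by rewrite subr_gt0.
set rh := (1 - T1) / (1 - T).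
pose h i (a : 'I_M.+1) : R := if i \in D then expR (s * rh * ((a < k)%N%:R - T)) else 1.
pose g i (a : 'I_M.+1) : R := if i \in D then expR (s * ((a < k1)%N%:R - T1)) else 1.
rewrite (Ex_eq _ (g := fun c => f [ffun i => capo k (c i)] * \prod_i h i (c i))); last first.
  by move=> c; rewrite fk expR_dev.
rewrite [leRHS](Ex_eq _ (g := fun c => f [ffun i => capo k (c i)] * \prod_i g i (c i))); last first.
  by move=> c; rewrite fk expR_dev.
apply: Ex_trunc_le => //.
  move=> i a; apply: mulr_ge0; first by case: (wP i).
  by rewrite /h; case: ifP => // _; exact: expR_ge0.
move=> i v; rewrite /h /g; case: (boolP (i \in D)) => iD //; rewrite wD//.
have [vk|vk] := ltnP v k.
  apply: ler_sum => a; rewrite /capo; case: (ltnP a k) => ak /eqP av; last first.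
    by move: vk; rewrite -av ltnn.
  rewrite (leq_trans ak kk1).
  have e : s * rh * (1 - T) = s * (1 - T1) by rewrite /rh; field; rewrite gt_eqF.
  by rewrite /= e.
have [->|vnk] := eqVneq v k; last first.
  suff e a : (capo k a == v) = false by rewrite !big_pred0.
  rewrite /capo; case: (ltnP a k) => ak; last by rewrite eq_sym (negbTE vnk).
  by apply/negbTE; apply: contraL ak => /eqP ->; rewrite -leqNgt.
have cE a : (capo k a == k) = ~~ (a < k)%N.
  rewrite /capo; case: (ltnP a k) => ak; last exact: eqxx.
  by apply/negbTE; rewrite -(inj_eq val_inj)/= ltn_eqF.
rewrite !(eq_bigl _ _ cE).
set mu := s * rh * (0 - T).
apply: (@le_trans _ _ (expR mu * \sum_(a : 'I_M.+1 | ~~ (a < k)%N)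
    u a * (1 + (s * ((a < k1)%N%:R - T1) - mu)))); last first.
  rewrite mulr_sumr; apply: ler_sum => a _; rewrite mulrCA ler_wpM2l//.
    by case: uP.
  rewrite -ler_pdivlMl ?expR_gt0// -expRN -expRD [leRHS](_ : _ = expR (s * ((a < k1)%N%:R - T1) - mu)).
    exact: expR_ge1Dx.
  by congr expR; ring.
have -> : \sum_(a : 'I_M.+1 | ~~ (a < k)%N) u a * (1 + (s * ((a < k1)%N%:R - T1) - mu)) = 1 - T.
  have -> : \sum_(a : 'I_M.+1 | ~~ (a < k)%N) u a * (1 + (s * ((a < k1)%N%:R - T1) - mu)) =
      (1 - s * T1 - mu) * \sum_(a : 'I_M.+1 | ~~ (a < k)%N) u a +
      s * \sum_(a : 'I_M.+1 | ~~ (a < k)%N) u a * (a < k1)%N%:R.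
    rewrite [X in _ = X + _]mulr_sumr [X in _ = _ + X]mulr_sumr -big_split/=.
    by apply: eq_bigr => a _; ring.
  have -> : \sum_(a : 'I_M.+1 | ~~ (a < k)%N) u a * (a < k1)%N%:R = T1 - T.
    rewrite /T1 /cumul [in RHS](bigID (fun a : 'I_M.+1 => (a < k)%N))/=.
    rewrite [X in _ = X + _ - _](_ : _ = T); last first.
      apply: eq_bigl => a; case: (ltnP a k) => ak; rewrite ?andbF// andbT.
      exact: leq_trans kk1.
    rewrite addrAC subrr add0r [RHS]big_mkcondl [RHS]big_mkcond [LHS]big_mkcond/=.
    apply: eq_bigr => a _; case: ifP => ak //; case: ifP => //.
      by rewrite mulr1.
    by rewrite mulr0.
  rewrite cumulC// -/T /mu /rh; field; by rewrite gt_eqF.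
rewrite -cumulC// mulr_sumr le_eqVlt; apply/orP; left; apply/eqP.
by apply: eq_bigr => a /negbTE ->; rewrite mulrC.
Qed.
End Deviations.

Section Maximal.
Context {R : realType} {I : finType} {M : nat}.
Implicit Types (w : I -> 'I_M.+1 -> R) (u : 'I_M.+1 -> R) (D : {set I}).
Implicit Types (c : {ffun I -> 'I_M.+1}).

Lemma sum_first (n : nat) (P : pred 'I_n) :
  \sum_(k < n) (P k && [forall j : 'I_n, (j < k)%N ==> ~~ P j])%:R = [exists k, P k]%:R :> R.
Proof.
case: (boolP [exists k, P k]) => [/existsP[k Pk]|/existsPn Pn]; last first.
  by rewrite big1// => k _; rewrite (negbTE (Pn k)).
case: (arg_minnP (fun k : 'I_n => k : nat) Pk) => k0 Pk0 k0min.
rewrite (bigD1 k0)//= big1 => [|j jk0].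
  rewrite Pk0/= addr0; case: forallP => // -[] j; apply/implyP => jk0.
  by apply: contraL jk0 => /k0min; rewrite -leqNgt.
case: (boolP (P j)) => //= Pj; case: forallP => // /(_ k0).
rewrite Pk0 implybF -leqNgt => jk; exfalso; move: jk0.
by rewrite -(inj_eq val_inj)/= eqn_leq jk (k0min _ Pj).
Qed.

(* Doob's maximal inequality on a block of indices where 1 - T varies by a factor at most r. *)
Lemma block_tail w u D (Q : pred 'I_M.+1) (sg b r v : R) :
  (forall i, is_pmf (w i)) -> is_pmf u -> (forall i, i \in D -> w i = u) ->
  sg ^+ 2 = 1 -> 0 <= b -> 0 <= r -> 0 < v -> #|D|%:R <= v ->
  (forall k, Q k -> cumul u k < 1) ->
  (forall k k1 : 'I_M.+1, Q k -> Q k1 -> r * (1 - cumul u k) <= 1 - cumul u k1) ->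
  Ex w (fun c => [exists k : 'I_M.+1, Q k && (b <= sg * dev D u k c)%R]%:R) <=
  expR (- (2 * (r * b) ^+ 2 / v)).
Proof.
move=> wP uP wD sg1 b0 r0 v0 Dv Q1 Qr.
have w0 i a : 0 <= w i a by case: (wP i).
have [/existsP[kq Qkq]|/existsPn Qn] := boolP [exists k, Q k]; last first.
  rewrite (Ex_eq _ (g := fun=> 0)) ?Ex_cst ?expR_ge0// => c.
  by case: existsP => // -[k]; rewrite (negbTE (Qn k)).
case: (arg_maxnP (fun k : 'I_M.+1 => k : nat) Qkq) => k1 Qk1 k1max.
pose P c (k : 'I_M.+1) := Q k && (b <= sg * dev D u k c).
pose f k c : R := (P c k && [forall j : 'I_M.+1, (j < k)%N ==> ~~ P c j])%:R.
have f0 k c : 0 <= f k c by rewrite ler0n.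
pose s := 4 * (r * b) / v.
have s0 : 0 <= s by rewrite /s divr_ge0// ?mulr_ge0// ltW.
have step k : expR (s * (r * b)) * Ex w (f k) <=
    Ex w (fun c => f k c * expR (s * sg * dev D u k1 c)).
  have [Qk|Qk] := boolP (Q k); last first.
    rewrite (Ex_eq _ (g := fun=> 0)) ?Ex_cst ?mulr0//; last first.
      by move=> c; rewrite /f /P (negbTE Qk).
    rewrite (Ex_eq _ (g := fun=> 0)) ?Ex_cst// => c.
    by rewrite /f /P (negbTE Qk) mul0r.
  apply: le_trans (dev_submart (s * sg) wP uP wD (k1max _ Qk) (Q1 _ Qk) (f0 k) _).
    rewrite -ExZ; apply: Ex_le => // c _; rewrite mulrC /f.
    case: (boolP (P c k)) => [/andP[_ bk]|_] /=; last by rewrite !mul0r.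
    rewrite ler_wpM2l// ler_expR.
    have rr : r <= (1 - cumul u k1) / (1 - cumul u k).
      by rewrite ler_pdivlMr ?subr_gt0 ?Q1// Qr.
    set q := _ / _ in rr *.
    rewrite [leRHS](_ : _ = s * (q * (sg * dev D u k c))); last by ring.
    by rewrite ler_wpM2l// ler_pM.
  move=> c; rewrite /f; congr ((_ && _)%:R).
    by rewrite /P dev_capo.
  apply: eq_forallb => j; case: (ltnP j k) => //= jk.
  by rewrite /P dev_capo// ltnW.
have : expR (s * (r * b)) * Ex w (fun c => [exists k : 'I_M.+1, P c k]%:R) <=
    expR (v * (s ^+ 2 / 8)).
  apply: (@le_trans _ _ (Ex w (fun c => expR (s * sg * dev D u k1 c)))); last first.
    apply: le_trans (mgf_dev _ _ wP uP wD) _.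
    by rewrite ler_expR exprMn sg1 mulr1 ler_wpM2r// divr_ge0 ?sqr_ge0.
  rewrite (Ex_eq _ (g := fun c => \sum_k f k c)); last by move=> c; rewrite sum_first.
  rewrite Ex_sum mulr_sumr; apply: le_trans (ler_sum _ (fun k _ => step k)) _.
  rewrite -Ex_sum; apply: Ex_le => // c _; rewrite -mulr_suml sum_first.
  by rewrite ler_piMl ?expR_ge0// lern1 leq_b1.
rewrite -ler_pdivlMl ?expR_gt0// -expRN -expRD => /le_trans; apply.
rewrite ler_expR le_eqVlt; apply/orP; left; apply/eqP.
by rewrite /s; field; rewrite gt_eqF.
Qed.

(* Blocks 1 - T in [r^(j+1), r^j] for j < J, with r = sqrt z. *)
Lemma half_tail w u D (J : nat) (sg b z v : R) :
  (forall i, is_pmf (w i)) -> is_pmf u -> (forall i, i \in D -> w i = u) ->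
  sg ^+ 2 = 1 -> 0 <= b -> 0 <= z -> 0 < v -> #|D|%:R <= v -> z ^+ J <= 4^-1 ->
  Ex w (fun c => [exists k : 'I_M.+1,
     (cumul u k <= 2^-1) && (b <= sg * dev D u k c)%R]%:R) <=
  J%:R * expR (- (z * (2 * b ^+ 2 / v))).
Proof.
move=> wP uP wD sg1 b0 z0 v0 Dv zJ.
pose r := Num.sqrt z.
have r0 : 0 <= r by exact: sqrtr_ge0.
have r2 : r ^+ 2 = z by rewrite sqr_sqrtr.
have rJ : r ^+ J <= 2^-1.
  rewrite -ler_sqr ?nnegrE ?exprn_ge0// ?invr_ge0// -exprM mulnC exprM r2.
  by apply: le_trans zJ _; rewrite expr2; lra.
pose Q (j : 'I_J) (k : 'I_M.+1) :=
  (cumul u k <= 2^-1) && (r ^+ j.+1 <= 1 - cumul u k <= r ^+ j).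
apply: (@le_trans _ _ (Ex w (fun c => \sum_j
   [exists k : 'I_M.+1, Q j k && (b <= sg * dev D u k c)%R]%:R))).
  apply: Ex_le => [i a|c _]; first by case: (wP i).
  case: existsP => [[k /andP[k2 bk]]|_]; last by apply: sumr_ge0.
  have [J0|J0] := posnP J; first by exfalso; move: rJ; rewrite J0 expr0; lra.
  pose S j := (j < J)%N && (1 - cumul u k <= r ^+ j).
  have ex : exists j, S j.
    by exists 0%N; rewrite /S J0 expr0 gerBl cumul_ge0.
  case: (ex_maxnP ex (m := J)) => [j /andP[/ltnW//]|j /andP[jJ kj] jmax].
  rewrite (bigD1 (Ordinal jJ))//=.
  suff -> : [exists k, Q (Ordinal jJ) k && (b <= sg * dev D u k c)%R].
    by rewrite lerDl sumr_ge0.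
  apply/existsP; exists k; rewrite bk andbT /Q k2 kj andbT/=.
  have [jJ'|Jj] := ltnP j.+1 J.
    rewrite leNgt; apply/negP => /ltW h.
    by have := jmax j.+1; rewrite /S jJ' h => /(_ isT); rewrite ltnn.
  have -> : j.+1 = J by apply/eqP; rewrite eqn_leq jJ.
  by apply: le_trans rJ _; move: k2; lra.
rewrite Ex_sum; apply: le_trans (_ : \sum_(j < J) expR (- (z * (2 * b ^+ 2 / v))) <= _).
  apply: ler_sum => j _.
  have -> : - (z * (2 * b ^+ 2 / v)) = - (2 * (r * b) ^+ 2 / v).
    by rewrite exprMn r2; ring.
  apply: block_tail => //.
    by move=> k /andP[k2 _]; lra.
  move=> k k1 /and3P[_ _ hk] /and3P[_ hk1 _].
  by apply: le_trans hk1; rewrite exprS ler_wpM2l.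
by rewrite sumr_const card_ord [leRHS]mulr_natl.
Qed.

Definition revc c : {ffun I -> 'I_M.+1} := [ffun i => rev_ord (c i)].

Lemma revcK : involutive revc.
Proof. by move=> c; apply/ffunP => i; rewrite !ffunE rev_ordK. Qed.

Lemma Ex_rev w f : Ex w f = Ex (fun i a => w i (rev_ord a)) (fun c => f (revc c)).
Proof.
rewrite /Ex (reindex_inj (inv_inj revcK))/=; apply: eq_bigr => c _; congr (_ * _).
by apply: eq_bigr => i _; rewrite ffunE.
Qed.

Lemma pmf_rev u : is_pmf u -> is_pmf (u \o @rev_ord M.+1).
Proof.
move=> [u0 u1]; split=> [a|]; first exact: u0.
by rewrite -u1 [RHS](reindex_inj rev_ord_inj).
Qed.

Lemma rev_ord_lt (a k : 'I_M.+1) : (0 < k)%N ->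
  (rev_ord a < M.+1 - k)%N = ~~ (a < k)%N.
Proof. by move=> k0 /=; have := ltn_ord k; lia. Qed.

Lemma cumul_rev u (k : 'I_M.+1) : is_pmf u -> (0 < k)%N ->
  cumul (u \o @rev_ord M.+1) (M.+1 - k) = 1 - cumul u k.
Proof.
move=> uP k0; rewrite -cumulC// /cumul (reindex_inj rev_ord_inj)/=.
apply: eq_big => [a|a _]; first by rewrite rev_ord_lt.
by rewrite rev_ordK.
Qed.

Lemma dev_rev u D (k : 'I_M.+1) c : is_pmf u -> (0 < k)%N ->
  dev D (u \o @rev_ord M.+1) (M.+1 - k) (revc c) = - dev D u k c.
Proof.
move=> uP k0; rewrite /dev -[RHS]sumrN; apply: eq_bigr => i _.
rewrite ffunE rev_ord_lt// cumul_rev//; case: ltnP => _ /=; lra.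
Qed.

Lemma sup_tail w u D (J : nat) (sg b z v : R) :
  (forall i, is_pmf (w i)) -> is_pmf u -> (forall i, i \in D -> w i = u) ->
  sg ^+ 2 = 1 -> 0 <= b -> 0 <= z -> 0 < v -> #|D|%:R <= v -> z ^+ J <= 4^-1 ->
  Ex w (fun c => [exists k : 'I_M.+1, (0 < k)%N && (b <= sg * dev D u k c)%R]%:R) <=
  J.*2%:R * expR (- (z * (2 * b ^+ 2 / v))).
Proof.
move=> wP uP wD sg1 b0 z0 v0 Dv zJ.
rewrite -addnn natrD mulrDl.
have h1 := half_tail wP uP wD sg1 b0 z0 v0 Dv zJ.
have h2 : Ex w (fun c => [exists k : 'I_M.+1,
     [&& (0 < k)%N, (2^-1 <= cumul u k) & (b <= sg * dev D u k c)%R]]%:R) <=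
  J%:R * expR (- (z * (2 * b ^+ 2 / v))).
  rewrite Ex_rev.
  have wP' i : is_pmf ((w i) \o @rev_ord M.+1) by exact: pmf_rev.
  have wD' i : i \in D -> w i \o @rev_ord M.+1 = u \o @rev_ord M.+1 by move=> /wD ->.
  have sg1' : (- sg) ^+ 2 = 1 by rewrite sqrrN.
  apply: le_trans (half_tail wP' (pmf_rev uP) wD' sg1' b0 z0 v0 Dv zJ).
  apply: Ex_le => [i a|c _]; first by case: (wP i).
  case: existsP => [[k /and3P[k0 k2 bk]]|_]; last by rewrite ler0n.
  have kM : (M.+1 - k < M.+1)%N by rewrite ltn_subrL k0.
  suff -> : [exists k : 'I_M.+1, (cumul (u \o @rev_ord M.+1) k <= 2^-1) &&
    (b <= - sg * dev D (u \o @rev_ord M.+1) k c)%R] by [].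
  apply/existsP; exists (Ordinal kM) => /=.
  rewrite cumul_rev// -[c]revcK dev_rev// mulrNN bk andbT; lra.
apply: le_trans (lerD h1 h2); rewrite -ExD; apply: Ex_le => [i a|c _].
  by case: (wP i).
case: existsP => [[k /andP[k0 bk]]|_]; last by rewrite addr_ge0.
have [k2|k2] := leP (cumul u k) 2^-1.
  suff -> : [exists k : 'I_M.+1, (cumul u k <= 2^-1) && (b <= sg * dev D u k c)%R].
    by rewrite lerDl.
  by apply/existsP; exists k; rewrite k2.
suff -> : [exists k : 'I_M.+1,
  [&& (0 < k)%N, (2^-1 <= cumul u k) & (b <= sg * dev D u k c)%R]] by rewrite lerDr.
by apply/existsP; exists k; rewrite k0 (ltW k2).
Qed.
End Maximal.

Section BlockCount.
Context {R : realType}.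

Lemma bernoulli2 (y : R) (q : nat) : 0 <= y ->
  1 + q%:R * y + q%:R * (q%:R - 1) / 2 * y ^+ 2 <= (1 + y) ^+ q.
Proof.
move=> y0; elim: q => [|q IH]; first by rewrite expr0; lra.
rewrite [leRHS]exprS; have y1 : 0 <= 1 + y by lra.
apply: (le_trans _ (ler_wpM2l y1 IH)).
have q2 : 0 <= q%:R * (q%:R - 1) / 2 * y ^+ 3 :> R.
  rewrite mulr_ge0 ?exprn_ge0// divr_ge0//; case: q {IH} => [|q].
    by rewrite mul0r.
  by rewrite -natr1 addrK mulr_ge0// addr_ge0.
rewrite -natr1 -subr_ge0; move: q2; set t := q%:R => q2.
suff -> : (1 + y) * (1 + t * y + t * (t - 1) / 2 * y ^+ 2) -
   (1 + (t + 1) * y + (t + 1) * (t + 1 - 1) / 2 * y ^+ 2) = t * (t - 1) / 2 * y ^+ 3 by [].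
by field.
Qed.

Lemma block_count (z : R) : 0 < z < 1 ->
  exists J : nat, z ^+ J <= 4^-1 /\ J.*2%:R + 1 <= 4 / (1 - z).
Proof.
move=> /andP[z0 z1].
pose y := (1 - z) / z.
have y0 : 0 < y by rewrite divr_gt0// subr_gt0.
have yz : 1 + y = z^-1 by rewrite /y; field; rewrite gt_eqF.
have zq q : (z ^+ q <= 4^-1) = (4 <= (1 + y) ^+ q).
  by rewrite yz exprVn -[in RHS](invrK 4) lef_pV2 ?posrE ?exprn_gt0.
have ex : exists n, z ^+ n <= 4^-1.
  exists (Num.truncn (3 / y)).+1; rewrite zq.
  have := bernoulli2 (Num.truncn (3 / y)).+1 (ltW y0); apply: le_trans.
  have h : 3 / y < (Num.truncn (3 / y)).+1%:R by exact: truncnS_gt.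
  rewrite ltr_pdivrMr// in h.
  apply: (@le_trans _ _ (1 + (Num.truncn (3 / y)).+1%:R * y)); first by lra.
  rewrite lerDl mulr_ge0 ?sqr_ge0// divr_ge0// mulr_ge0//.
case: (ex_minnP ex) => J zJ Jmin; exists J; split=> //.
rewrite ler_pdivlMr ?subr_gt0//.
case: J zJ Jmin => [|[|q]] zJ Jmin.
- by rewrite double0 add0r mul1r; lra.
- by rewrite -[1.*2]/2%N; lra.
have : ~~ (z ^+ q.+1 <= 4^-1) by apply/negP => /Jmin; rewrite ltnn.
rewrite zq -ltNge => h.
rewrite leNgt; apply/negP => big.
have := bernoulli2 q.+1 (ltW y0).
have tE : q.+2.*2%:R = 2 * q.+1%:R + 2 :> R by rewrite -mul2n natrM -(natr1 q.+1); ring.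
have qy : 4 < (2 * q.+1%:R - 1) * y.
  rewrite /y mulrA ltr_pdivlMr//; move: big; rewrite tE; set t := q.+1%:R; nra.
move: h qy; set X := (1 + y) ^+ _; rewrite -(natr1 q).
have [->|q0] := posnP q; first by lra.
have q1 : 1 <= q%:R :> R by rewrite ler1n.
move: q1; set t : R := q%:R => q1 X4 qy hX.
have : 16 <= ((2 * (t + 1) - 1) * y) ^+ 2.
  have -> : 16 = 4 ^+ 2 :> R by ring.
  by rewrite ler_sqr ?nnegrE// ltW// (lt_trans _ qy).
have : 0 <= y ^+ 2 * (t - 1) by rewrite mulr_ge0 ?sqr_ge0 ?subr_ge0.
have : 0 <= y ^+ 2 * (t - 1) ^+ 2 by rewrite mulr_ge0 ?sqr_ge0.
have : 0 <= y ^+ 2 by rewrite sqr_ge0.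
nra.
Qed.
End BlockCount.

(** * The step-up-down index *)

Section StepUpDown.

Definition isK (m lam : nat) (cnt : nat -> nat) (K : nat) : Prop :=
  (K <= m)%N /\
  ([/\ (lam <= K)%N, (forall k, lam <= k <= K -> k <= cnt k)%N &
       ((K < m) -> cnt K.+1 <= K)%N] \/
   [/\ (K < lam)%N, (K <= cnt K)%N & (forall k, K < k <= lam -> cnt k < k)%N]).

Definition khat (m lam : nat) (cnt : nat -> nat) : nat :=
  if (lam <= cnt lam)%N then
    \big[maxn/0%N]_(k < m.+1 | (lam <= k)%N &&
        [forall k' : 'I_m.+1, (lam <= k' <= k)%N ==> (k' <= cnt k')%N]) (nat_of_ord k)
  else \big[maxn/0%N]_(k < m.+1 | (k <= lam)%N && (k <= cnt k)%N) (nat_of_ord k).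

Lemma khatP (m lam : nat) (cnt : nat -> nat) : (1 <= lam <= m)%N ->
  isK m lam cnt (khat m lam cnt).
Proof.
move=> /andP[l1 lm]; rewrite /khat; case: leqP => hl.
  pose P (k : 'I_m.+1) := (lam <= k)%N &&
    [forall k' : 'I_m.+1, (lam <= k' <= k)%N ==> (k' <= cnt k')%N].
  have lm' : (lam < m.+1)%N by rewrite ltnS.
  have Pl : P (Ordinal lm').
    rewrite /P/= leqnn/=; apply/forallP => k; apply/implyP => h.
    by have -> : nat_of_ord k = lam by lia.
  have P0 : (0 < #|[pred k | P k]|)%N by apply/card_gt0P; exists (Ordinal lm').
  have [k0 Pk0 Kk0] := @eq_bigmax_cond _ [pred k | P k] (@nat_of_ord m.+1) P0.
  rewrite -/(\big[maxn/0%N]_(k in [pred k | P k]) (nat_of_ord k)) Kk0.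
  have k0max (k : 'I_m.+1) : P k -> (k <= k0)%N.
    by move=> Pk; rewrite -Kk0; apply: leq_bigmax_cond.
  move: Pk0; rewrite inE => /andP[lk0 /forallP hk0].
  split; first by rewrite -ltnS ltn_ord.
  left; split=> // [k /andP[k1 k2]|k0m].
    have km : (k < m.+1)%N by have := ltn_ord k0; lia.
    by have /implyP := hk0 (Ordinal km); apply; rewrite /= k1.
  rewrite leqNgt; apply/negP => h.
  have km : (k0.+1 < m.+1)%N by rewrite ltnS.
  suff : P (Ordinal km) by move=> /k0max; rewrite /= ltnn.
  rewrite /P/= leqW//=; apply/forallP => k; apply/implyP => /andP[k1 k2].
  have [e|ne] := eqVneq (nat_of_ord k) k0.+1; first by rewrite e.
  by have /implyP := hk0 k; apply; rewrite k1/=; lia.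
pose P (k : 'I_m.+1) := (k <= lam)%N && (k <= cnt k)%N.
have P0 : (0 < #|[pred k | P k]|)%N by apply/card_gt0P; exists ord0.
have [k0 Pk0 Kk0] := @eq_bigmax_cond _ [pred k | P k] (@nat_of_ord m.+1) P0.
rewrite -/(\big[maxn/0%N]_(k in [pred k | P k]) (nat_of_ord k)) Kk0.
have k0max (k : 'I_m.+1) : P k -> (k <= k0)%N.
  by move=> Pk; rewrite -Kk0; apply: leq_bigmax_cond.
move: Pk0; rewrite inE => /andP[lk0 hk0].
split; first by rewrite -ltnS ltn_ord.
right; split=> //.
  rewrite ltn_neqAle lk0 andbT; apply/eqP => e.
  by move: hl; rewrite -e ltnNge hk0.
move=> k /andP[k1 k2]; rewrite ltnNge; apply/negP => h.
have km : (k < m.+1)%N by lia.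
suff : P (Ordinal km) by move=> /k0max; rewrite /= leqNgt k1.
by rewrite /P/= k2.
Qed.

Lemma isK_le (m lam : nat) (cnt cnt' : nat -> nat) K K' : (1 <= lam <= m)%N ->
  (forall k, (1 <= k <= m)%N -> (cnt k <= cnt' k)%N) ->
  isK m lam cnt K -> isK m lam cnt' K' -> (K <= K')%N.
Proof.
move=> lm hc [Km hK] [K'm hK']; rewrite leqNgt; apply/negP => KK.
case: hK => [[lK hk _]|[Kl hk _]]; case: hK' => [[lK' _ hk']|[K'l _ hk']].
- have := hk K'.+1; have := hk' _; have := hc K'.+1.
  move=> /(_ ltac:(lia)) h1 /(_ ltac:(lia)) h2 /(_ ltac:(lia)); lia.
- have := hk lam; have := hk' lam; have := hc lam.
  move=> /(_ ltac:(lia)) h1 /(_ ltac:(lia)) h2 /(_ ltac:(lia)); lia.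
- lia.
- have := hk' K; have := hc K.
  move=> /(_ ltac:(lia)) h1 /(_ ltac:(lia)); lia.
Qed.

Lemma isK_uniq (m lam : nat) (cnt : nat -> nat) K K' : (1 <= lam <= m)%N ->
  isK m lam cnt K -> isK m lam cnt K' -> K = K'.
Proof.
by move=> lm h h'; apply/eqP; rewrite eqn_leq (isK_le _ _ h h')// (isK_le _ _ h' h).
Qed.

Lemma khat_le (m lam : nat) (cnt cnt' : nat -> nat) : (1 <= lam <= m)%N ->
  (forall k, (1 <= k <= m)%N -> (cnt k <= cnt' k)%N) ->
  (khat m lam cnt <= khat m lam cnt')%N.
Proof. by move=> lm h; apply: (isK_le lm h); apply: khatP. Qed.

Lemma isK_cnt (m lam : nat) (cnt : nat -> nat) K : (lam <= m)%N ->
  (forall k, (cnt k <= m)%N) -> (forall k k', (k <= k')%N -> (cnt k <= cnt k')%N) ->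
  isK m lam cnt K -> cnt K = K.
Proof.
move=> lm cm cle [Km hK]; have := cle K K.+1 (leqnSn _).
case: hK => [[lK hk h]|[Kl hk h]] hc; apply/eqP; rewrite eqn_leq.
  have [KM|KM] := ltnP K m.
    by rewrite (leq_trans hc (h KM)) hk// lK leqnn.
  by have := cm K; have := hk K; lia.
by have := h K.+1; lia.
Qed.

Context {m : nat}.
Implicit Type (c : {ffun 'I_m -> 'I_m.+1}).

Definition cnt c (k : nat) : nat := #|[set i | (c i < k)%N]%SET|.

Lemma cnt_le_m c k : (cnt c k <= m)%N.
Proof. by rewrite -[leqRHS]card_ord; exact: max_card. Qed.

Lemma cnt_mono c k k' : (k <= k')%N -> (cnt c k <= cnt c k')%N.
Proof.
move=> kk; apply/subset_leq_card/fintype.subsetP => i; rewrite !inE => /leq_trans; exact.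
Qed.

Lemma cnt_anti c c' k : (forall i, c' i <= c i)%N -> (cnt c k <= cnt c' k)%N.
Proof.
move=> cc; apply/subset_leq_card/fintype.subsetP => i; rewrite !inE.
exact: leq_ltn_trans.
Qed.

Lemma khat_cnt lam c : (1 <= lam <= m)%N ->
  cnt c (khat m lam (cnt c)) = khat m lam (cnt c).
Proof.
move=> lm; have /andP[_ lm'] := lm; have := khatP (cnt c) lm; apply: isK_cnt => //.
  exact: cnt_le_m.
exact: cnt_mono.
Qed.

Lemma khat_upd0 lam c (i : 'I_m) : (1 <= lam <= m)%N ->
  (c i < khat m lam (cnt c))%N -> khat m lam (cnt (upd c i ord0)) = khat m lam (cnt c).
Proof.
move=> lm ciK; apply: (isK_uniq lm (khatP _ lm)).
have le0 k : (cnt c k <= cnt (upd c i ord0) k)%N.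
  by apply: cnt_anti => j; rewrite ffunE; case: ifP.
have eqk k : (khat m lam (cnt c) < k)%N -> cnt (upd c i ord0) k = cnt c k.
  move=> Kk; apply: eq_card => j; rewrite !inE ffunE; case: eqVneq => // ->.
  by rewrite (leq_ltn_trans (leq0n _) Kk) (ltn_trans ciK Kk).
have [Km h] := khatP (cnt c) lm; split=> //.
case: h => [[h1 h2 h3]|[h1 h2 h3]]; [left|right]; split=> //.
- by move=> k /h2 /leq_trans; apply.
- by move=> /h3; rewrite eqk.
- exact: leq_trans (le0 _).
- by move=> k /[dup] /h3 h /andP[Kk _]; rewrite eqk.
Qed.

End StepUpDown.

Section Cells.
Context {R : realType} {m : nat}.

Lemma nth_sorted_le (s : seq R) (k : nat) (x : R) : sorted <=%R s -> (k < size s)%N ->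
  (nth 0 s k <= x) = (k < count (fun y => (y <= x)%R) s)%N.
Proof.
elim: s k => // a s IH k /= pas ks.
have ss : sorted <=%R s by exact: path_sorted pas.
have /allP as_ : all (fun y => a <= y) s by move: pas; rewrite path_sortedE => [/andP[]|]//; exact: le_trans.
case: (leP a x) => ax /=.
  by case: k ks => [|k] ks /=; rewrite ?ax// add1n ltnS IH.
have -> : count (fun y => (y <= x)%R) s = 0%N.
  apply/eqP; rewrite -leqn0 leqNgt -has_count; apply/negP => /hasP[y /as_ ay yx].
  by have := le_trans ay yx; rewrite leNgt ax.
rewrite addn0 ltn0; apply/negbTE; rewrite -ltNge.
case: k ks => [|k] ks //=.
by rewrite (lt_le_trans ax)// as_// mem_nth.
Qed.

Lemma order_stat_le (p : 'I_m -> R) (k : nat) (x : R) : (1 <= k <= m)%N ->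
  (order_stat p k <= x) = (k <= \sum_(i < m | (p i <= x)%R) 1)%N.
Proof.
case: k => // k /= km; rewrite nth_sorted_le.
- rewrite count_sort count_map -sum1_count big_enum_cond/=.
  by [].
- exact: sort_sorted le_total _.
- by rewrite size_sort size_map size_enum_ord.
Qed.

Definition cellof (t : nat -> R) (x : R) : 'I_m.+1 :=
  inord (\sum_(k < m) (t k.+1 < x)%R).

Lemma cellofP (t : nat -> R) (x : R) (k : nat) :
  (forall i j, (1 <= i)%N -> (i <= j)%N -> (j <= m)%N -> t i <= t j) ->
  (1 <= k <= m)%N -> (cellof t x < k)%N = (x <= t k).
Proof.
move=> tle /andP[k1 km].
have lm : (\sum_(k < m) (t k.+1 < x)%R < m.+1)%N.
  rewrite ltnS -[leqRHS](card_ord m) -sum1_card; apply: leq_sum => i _; exact: leq_b1.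
rewrite /cellof inordK//.
have E : (\sum_(j < m) (t j.+1 < x)%R = \sum_(0 <= j < m) (t j.+1 < x)%R)%N.
  by rewrite big_mkord.
rewrite E (big_cat_nat (n := k))//=.
case: leP => h.
  rewrite [X in (_ + X)%N]big_nat_cond [X in (_ + X)%N]big1 ?addn0; last first.
    move=> j /andP[/andP[kj jm] _]; rewrite ltNge (le_trans h)// tle//; lia.
  rewrite (big_cat_nat (n := k.-1))//= ?leq_pred//.
  rewrite [X in (_ + X)%N]big_nat_cond [X in (_ + X)%N]big1 ?addn0; last first.
    move=> j /andP[/andP[kj jk] _]; have -> : j.+1 = k by lia.
    by rewrite ltNge h.
  apply: (@leq_ltn_trans k.-1); last by lia.
  rewrite -[leqRHS]subn0 -[leqRHS]muln1 -sum_nat_const_nat.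
  by apply: leq_sum => j _; exact: leq_b1.
apply/negbTE; rewrite -leqNgt; apply: leq_trans (leq_addr _ _).
rewrite -[leqLHS]subn0 -[leqLHS]muln1 -sum_nat_const_nat big_nat_cond [leqRHS]big_nat_cond.
apply: leq_sum => j /andP[/andP[_ jk] _].
by rewrite (le_lt_trans _ h)// tle.
Qed.

Definition fdpd (m0 lam : nat) (c : {ffun 'I_m -> 'I_m.+1}) : R :=
  let K := khat m lam (cnt c) in
  \sum_(i < m | (i < m0)%N) ((c i < K)%N%:R / (maxn K 1)%:R).

Lemma fdp_cell (t : nat -> R) (m0 lam : nat) (p : 'I_m -> R) :
  (1 <= lam <= m)%N -> t 0%N = 0 -> (forall k, (1 <= k <= m)%N -> 0 <= t k) ->
  (forall i j, (1 <= i)%N -> (i <= j)%N -> (j <= m)%N -> t i <= t j) ->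
  fdp m0 lam t p = fdpd m0 lam [ffun i => cellof t (p i)].
Proof.
move=> lm t0 tge0 tle; set c := [ffun i => _].
have ct k : (1 <= k <= m)%N -> (\sum_(i < m | (p i <= t k)%R) 1)%N = cnt c k.
  move=> km; rewrite /cnt -sum1_card; apply: eq_bigl => i.
  by rewrite inE ffunE cellofP.
have os k : (k <= m)%N -> (order_stat p k <= t k) = (k <= cnt c k)%N.
  case: k => [_|k km]; first by rewrite /= t0 lexx.
  by rewrite order_stat_le// ct.
have KE : sud_khat lam t p = khat m lam (cnt c).
  rewrite /sud_khat /khat os; last by case/andP: lm.
  case: ifP => _; apply: eq_bigl => k; congr andb; last first.
    by rewrite os// -ltnS ltn_ord.
  by apply: eq_forallb => k'; rewrite os// -ltnS ltn_ord.
rewrite /fdp /fdpd KE; have := khatP (cnt c) lm; have := khat_cnt c lm.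
set K := khat _ _ _ => cK hK.
have [K0|K0] := posnP K.
  have c1 : cnt c 1 = 0%N.
    case: hK => _ [[]|[_ _ /(_ 1%N)]]; rewrite K0; first by lia.
    by move=> /(_ ltac:(lia)); lia.
  have pK i : (p i <= t K) = false.
    apply/negP; rewrite K0 t0 => pi0.
    have : (i \in [set i | (c i < 1)%N]%SET).
      rewrite inE ffunE cellofP//; last by lia.
      by apply: le_trans pi0 (tge0 _ _); lia.
    by move/eqP: c1; rewrite cards_eq0 => /eqP ->; rewrite inE.
  rewrite [X in X%:R / _]big_pred0; last by move=> i; rewrite pK andbF.
  by rewrite mul0r big1// => i _; rewrite K0 mul0r.
have Km : (1 <= K <= m)%N by rewrite K0; case: hK.
rewrite ct// cK -mulr_suml; congr (_ / _).
rewrite natr_sum big_mkcondr/=; apply: eq_bigr => i _.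
by rewrite ffunE cellofP//; case: ifP.
Qed.

End Cells.

(** * The functional U *)

Section Ucal.
Context {R : realType} (rho : R -> R) (tau : R).
Context (r01 : forall x : R, 0 <= x <= 1 -> 0 <= rho x <= 1).
Context (t01 : 0 <= tau <= 1).
Implicit Types G : R -> R.

Definition range01 G := forall x, 0 <= x <= 1 -> 0 <= G x <= 1.

Let Sinf G := [set u | tau <= u <= 1 /\ G (rho u) <= u].
Let Ssup G := [set u | 0 <= u <= tau /\ u <= G (rho u)].

Lemma Sinf_has_inf G : range01 G -> has_inf (Sinf G).
Proof.
move=> G01; split; last by exists tau => u [/andP[]].
exists 1; split; first by case/andP: t01 => _ ->; rewrite lexx.
have z01 : 0 <= (1 : R) <= 1 by rewrite ler01 lexx.
by have /andP[] := G01 _ (r01 z01).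
Qed.

Lemma Ssup_has_sup G : range01 G -> has_sup (Ssup G).
Proof.
move=> G01; split; last by exists tau => u [/andP[]].
exists 0; split; first by case/andP: t01 => ->; rewrite lexx.
have z01 : 0 <= (0 : R) <= 1 by rewrite ler01 lexx.
by have /andP[] := G01 _ (r01 z01).
Qed.

Lemma Ucal_infE G : tau <= G (rho tau) -> Ucal rho tau G = inf (Sinf G).
Proof. by rewrite /Ucal => ->. Qed.

Lemma Ucal_supE G : G (rho tau) < tau -> Ucal rho tau G = sup (Ssup G).
Proof. by rewrite /Ucal leNgt => ->. Qed.

Lemma Ucal_inf_bnd G : range01 G -> tau <= G (rho tau) -> tau <= Ucal rho tau G <= 1.
Proof.
move=> G01 h; rewrite Ucal_infE//; have [[x Sx] lb] := Sinf_has_inf G01.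
apply/andP; split; first by apply: lb_le_inf; [exists x|move=> u [/andP[]]].
apply: le_trans (_ : x <= _); last by case: Sx => /andP[].
exact: ge_inf.
Qed.

Lemma Ucal_sup_bnd G : range01 G -> G (rho tau) < tau -> 0 <= Ucal rho tau G <= tau.
Proof.
move=> G01 h; rewrite Ucal_supE//; have [[x Sx] ub] := Ssup_has_sup G01.
apply/andP; split; last by apply: ge_sup; [exists x|move=> u [/andP[]]].
apply: (@le_trans _ _ x); first by case: Sx => /andP[].
exact: ub_le_sup.
Qed.

Lemma Ucal_bnd G : range01 G -> 0 <= Ucal rho tau G <= 1.
Proof.
move=> G01; have /andP[t0 t1] := t01; have [h|h] := leP tau (G (rho tau)).
  have /andP[h1 ->] := Ucal_inf_bnd G01 h; by rewrite (le_trans t0 h1).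
by have /andP[-> h1] := Ucal_sup_bnd G01 h; rewrite (le_trans h1 t1).
Qed.

Lemma Ucal_le G G' : range01 G -> range01 G' ->
  (forall x, 0 <= x <= 1 -> G x <= G' x) -> Ucal rho tau G <= Ucal rho tau G'.
Proof.
move=> G01 G01' GG; have /andP[t0 t1] := t01.
have GGt := GG _ (r01 t01).
have [h|h] := leP tau (G (rho tau)).
  have h' := le_trans h GGt; rewrite !Ucal_infE//.
  have [_ lb] := Sinf_has_inf G01; have [ne' _] := Sinf_has_inf G01'.
  apply: lb_le_inf => // u [/andP[u1 u2] Gu]; apply: ge_inf => //; split; first by rewrite u1.
  by apply: le_trans Gu; apply: GG; apply: r01; rewrite u2 (le_trans t0 u1).
have [h'|h'] := leP tau (G' (rho tau)).
  have /andP[_ h1] := Ucal_sup_bnd G01 h; have /andP[h2 _] := Ucal_inf_bnd G01' h'.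
  exact: le_trans h1 h2.
rewrite !Ucal_supE//.
have [ne _] := Ssup_has_sup G01; have [_ ub] := Ssup_has_sup G01'.
apply: ge_sup => // u [/andP[u1 u2] Gu]; apply: ub_le_sup => //; split; first by rewrite u1.
by apply: le_trans Gu _; apply: GG; apply: r01; rewrite u1 (le_trans u2 t1).
Qed.

Lemma Ucal_inf_lt G x : range01 G -> tau <= G (rho tau) -> Ucal rho tau G < x ->
  exists u, [/\ Ucal rho tau G <= u, u < x, tau <= u <= 1 & G (rho u) <= u].
Proof.
move=> G01 h; rewrite Ucal_infE// => hx.
have hi := Sinf_has_inf G01; have [u Su ux] := inf_lt hi.1 hx.
by case: (Su) => u1 u2; exists u; split=> //; apply: ge_inf => //; case: hi.
Qed.

Lemma Ucal_sup_gt G x : range01 G -> G (rho tau) < tau -> x < Ucal rho tau G ->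
  exists u, [/\ u <= Ucal rho tau G, x < u, 0 <= u <= tau & u <= G (rho u)].
Proof.
move=> G01 h; rewrite Ucal_supE// => hx.
have hi := Ssup_has_sup G01; have [u Su ux] := sup_gt hi.1 hx.
by case: (Su) => u1 u2; exists u; split=> //; apply: ub_le_sup => //; case: hi.
Qed.

Lemma Ucal_inf_below G u : range01 G -> tau <= G (rho tau) -> tau <= u ->
  u < Ucal rho tau G -> u < G (rho u).
Proof.
move=> G01 h tu hu; rewrite ltNge; apply/negP => Gu.
have /andP[_ U1] := Ucal_inf_bnd G01 h.
move: (hu); rewrite Ucal_infE// ltNge => /negP; apply.
apply: ge_inf; first by case: (Sinf_has_inf G01).
by split=> //; rewrite tu (ltW (lt_le_trans hu U1)).
Qed.

Lemma Ucal_sup_above G u : range01 G -> G (rho tau) < tau -> u <= tau ->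
  Ucal rho tau G < u -> G (rho u) < u.
Proof.
move=> G01 h tu hu; rewrite ltNge; apply/negP => Gu.
have /andP[U0 _] := Ucal_sup_bnd G01 h.
move: (hu); rewrite Ucal_supE// ltNge => /negP; apply.
apply: ub_le_sup; first by case: (Ssup_has_sup G01).
by split=> //; rewrite tu (ltW (le_lt_trans U0 hu)).
Qed.

End Ucal.

Section Events.
Context {R : realType} (rho : R -> R) (m lam n : nat) (zeta delta nu : R).
Context (m0 : (0 < m)%N) (lm : (1 <= lam <= m)%N).
Context (r01 : forall x : R, 0 <= x <= 1 -> 0 <= rho x <= 1).
Context (rle : forall x y : R, 0 <= x -> x <= y -> y <= 1 -> rho x <= rho y).
Context (z0 : 0 < zeta) (z1 : zeta < 1) (d0 : 0 < delta) (d1 : delta < 1).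
Context (nnu : `|n%:R - m%:R * zeta| <= m%:R * nu).

Let tau : R := lam%:R / m%:R.
Let Gp (x : R) : R := Num.min (GDU zeta x + delta) 1.
Let Gm (x : R) : R := Num.max (GDU zeta x - delta) 0.
Let b : R := m%:R * (delta - nu - 1 / m%:R).

Let mR0 : 0 < (m%:R : R). Proof. by rewrite ltr0n. Qed.

Let kdiv (k : nat) : (k <= m)%N -> 0 <= (k%:R / m%:R : R) <= 1.
Proof. by move=> km; rewrite divr_ge0//= ler_pdivrMr// mul1r ler_nat. Qed.

Let tau01 : 0 <= tau <= 1. Proof. by apply: kdiv; case/andP: lm. Qed.

Let bE : b = m%:R * delta - m%:R * nu - 1.
Proof. by rewrite /b; field; rewrite gt_eqF. Qed.

Local Ltac slra := move: (z0) (z1) (d0) (d1); lra.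

Lemma range_Gp : range01 Gp.
Proof.
move=> x /andP[x0 x1]; rewrite /Gp le_min ge_min lexx ler01 orbT !andbT.
have zx : 0 <= zeta * x by rewrite mulr_ge0// ltW.
by rewrite /GDU; slra.
Qed.

Lemma range_Gm : range01 Gm.
Proof.
move=> x /andP[x0 x1]; rewrite /Gm le_max ge_max lexx ler01 orbT !andbT/=.
have zx : zeta * x <= zeta * 1 by rewrite ler_wpM2l// ltW.
by rewrite /GDU; slra.
Qed.

Lemma GmGp x : 0 <= x <= 1 -> Gm x <= Gp x.
Proof.
move=> /andP[x0 x1]; rewrite /Gm /Gp le_min !ge_max ler01 !andbT.
have zx : zeta * x <= zeta * 1 by rewrite ler_wpM2l// ltW.
have zx0 : 0 <= zeta * x by rewrite mulr_ge0// ltW.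
by rewrite /GDU; apply/andP; split; [apply/andP; split|]; slra.
Qed.

Lemma GDU_le x y : x <= y -> GDU zeta x <= GDU zeta y.
Proof. by move=> xy; rewrite /GDU lerD2l ler_wpM2l//; slra. Qed.

(* [dv] is the centred count of the other [n] nulls; [off] is 0 or 1 according to
   whether the distinguished null is moved to the first or to the last cell. *)
Definition cntrel (cnt : nat -> nat) (off : R) (dv : nat -> R) :=
  forall k, (1 <= k <= m)%N ->
  (cnt k)%:R = m%:R - n%:R * (1 - rho (k%:R / m%:R)) + dv k - off.

Let nnu1 k : (k <= m)%N ->
  - (m%:R * nu) <= (n%:R - m%:R * zeta) * (1 - rho (k%:R / m%:R)) <= m%:R * nu.
Proof.
move=> km; rewrite -ler_norml normrM; apply: le_trans nnu.
have /andP[h0 h1] := r01 (kdiv km).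
by rewrite ler_piMr// ger0_norm; slra.
Qed.

Lemma plus_inf : tau <= Gp (rho tau) -> exists k0, (1 <= k0 <= m)%N /\
  forall cnt K dv, isK m lam cnt K -> cntrel cnt 0 dv ->
  Ucal rho tau Gp < K%:R / m%:R -> b <= dv k0.
Proof.
move=> h; set U := Ucal _ _ _.
have /andP[U1 U2] : tau <= U <= 1 by exact: Ucal_inf_bnd range_Gp h.
pose k0 := Num.truncn (m%:R * U).
have U0 : 0 <= m%:R * U by rewrite mulr_ge0// (le_trans _ U1)//; case/andP: tau01.
have k0U : k0%:R <= m%:R * U by rewrite truncn_le.
have Uk0 : m%:R * U < k0.+1%:R by exact: truncnS_gt.
clearbody k0.
have lk0 : (lam <= k0)%N.
  rewrite -ltnS -(ltr_nat R); apply: le_lt_trans Uk0.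
  by move: U1; rewrite /tau ler_pdivrMr// mulrC.
have k0m : (k0 <= m)%N.
  rewrite -(ler_nat R); apply: le_trans k0U _; by rewrite ler_piMr.
have k01 : (1 <= k0 <= m)%N by move: lk0 k0m (lm); clear; lia.
exists k0; split=> // cnt K dv [Km hK] hc UK.
have k0K : (k0 < K)%N.
  by rewrite -(ltr_nat R); apply: le_lt_trans k0U _; move: UK; rewrite ltr_pdivlMr// mulrC.
have ck0 : (k0 <= cnt k0)%N.
  case: hK => [[_ hk _]|[Kl _ _]]; first by apply: hk; rewrite lk0 ltnW.
  by move: lk0 k0K Kl; clear; lia.
have Uk : U < k0.+1%:R / m%:R by rewrite ltr_pdivlMr// mulrC.
have [u [Uu uk /andP[tu u1] Gu]] := Ucal_inf_lt r01 tau01 range_Gp h Uk.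
have u11 : u < 1.
  by apply: lt_le_trans uk _; rewrite ler_pdivrMr// mul1r ler_nat (leq_trans k0K).
have Gu' : GDU zeta (rho u) + delta <= u.
  by move: Gu; rewrite /Gp ge_min (leNgt 1) u11 orbF.
have rk : rho (k0%:R / m%:R) <= rho u.
  have /andP[k0d _] := kdiv k0m; apply: rle => //.
  by apply: le_trans Uu; rewrite ler_pdivrMr// [leRHS]mulrC.
have := hc _ k01; have /andP[h1 _] := nnu1 k0m.
have := GDU_le rk; have : k0%:R <= (cnt k0)%:R :> R by rewrite ler_nat.
move: uk; rewrite ltr_pdivlMr// -natr1 bE /GDU.
have : m%:R * (GDU zeta (rho u) + delta) <= m%:R * u by rewrite ler_wpM2l// ltW.
rewrite /GDU; set r := rho (_ / _) in h1 *; set r' := rho u => e1 e2 e3 e4 e5.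
have : m%:R * (1 - zeta + zeta * r) <= m%:R * (1 - zeta + zeta * r') by rewrite ler_wpM2l// ltW.
move: e1 e2 e3 e5 h1; slra.
Qed.

Lemma plus_sup : Gp (rho tau) < tau ->
  forall cnt K dv, isK m lam cnt K -> cntrel cnt 0 dv ->
  Ucal rho tau Gp < K%:R / m%:R -> exists k0, (1 <= k0 <= m)%N /\ b <= dv k0.
Proof.
move=> h cnt K dv [Km hK] hc UK.
have /andP[U0 Ut] := Ucal_sup_bnd r01 tau01 range_Gp h.
have [k [k1 kl kc Gk]] : exists k, [/\ (1 <= k)%N, (k <= lam)%N, (k <= cnt k)%N &
    Gp (rho (k%:R / m%:R)) < k%:R / m%:R].
  case: hK => [[lK hk _]|[Kl hk _]].
    exists lam; split=> //; first by case/andP: lm.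
    by apply: hk; rewrite leqnn lK.
  exists K; split=> //; last 2 first.
  - exact: ltnW.
  - apply: (Ucal_sup_above r01 tau01 range_Gp h) => //.
    by rewrite /tau ler_pM2r ?invr_gt0// ler_nat ltnW.
  have : 0 < K%:R / m%:R :> R by exact: le_lt_trans UK.
  by rewrite pmulr_lgt0 ?invr_gt0// ltr0n.
have km : (k <= m)%N by apply: leq_trans kl _; case/andP: lm.
have k1m : (1 <= k <= m)%N by rewrite k1.
exists k; split=> //.
have Gk' : GDU zeta (rho (k%:R / m%:R)) + delta < k%:R / m%:R.
  have /andP[_ kd] := kdiv km.
  by move: Gk; rewrite /Gp gt_min => /orP[//|]; rewrite ltNge kd.
have := hc _ k1m; have /andP[h1 _] := nnu1 km.
have : k%:R <= (cnt k)%:R :> R by rewrite ler_nat.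
move: Gk'; rewrite ltr_pdivlMr// bE /GDU; move: h1; set r := rho _; slra.
Qed.

Lemma minus_sup : Gm (rho tau) < tau -> exists k0, (1 <= k0 <= m)%N /\
  forall cnt K dv, isK m lam cnt K -> cntrel cnt 1 dv ->
  K%:R / m%:R < Ucal rho tau Gm -> b <= - dv k0.
Proof.
move=> h; set U := Ucal _ _ _.
have /andP[U0 U1] : 0 <= U <= tau by exact: Ucal_sup_bnd range_Gm h.
have ex : exists k, m%:R * U <= k%:R.
  by exists lam; move: U1; rewrite /tau ler_pdivlMr// mulrC.
case: (ex_minnP ex) => -[|k0] Uk0 k0min.
  exists lam; split=> // cnt K dv _ _ KU; exfalso; move: KU; rewrite ltr_pdivrMr// mulrC.
  by move=> /lt_le_trans/(_ Uk0); rewrite ltr_nat.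
have k0l : (k0.+1 <= lam)%N by apply: k0min; move: U1; rewrite /tau ler_pdivlMr// mulrC.
have k0U : k0%:R < m%:R * U by rewrite ltNge; apply/negP => /k0min; rewrite ltnn.
have k0m : (k0.+1 <= m)%N by apply: leq_trans k0l _; case/andP: lm.
exists k0.+1; split=> // cnt K dv [Km hK] hc KU.
have Kk0 : (K < k0.+1)%N.
  by rewrite -(ltr_nat R); apply: lt_le_trans Uk0; move: KU; rewrite ltr_pdivrMr// mulrC.
have ck0 : (cnt k0.+1 < k0.+1)%N.
  case: hK => [[lK _ _]|[Kl _ hk]]; last by apply: hk; rewrite Kk0.
  by move: lK Kk0 k0l; clear; lia.
have kU : k0%:R / m%:R < U by rewrite ltr_pdivrMr// mulrC.
have [u [Uu uk /andP[u0 ut] Gu]] := Ucal_sup_gt r01 tau01 range_Gm h kU.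
have u00 : 0 < u by apply: le_lt_trans uk; case/andP: (kdiv (ltnW k0m)).
have Gu' : u <= GDU zeta (rho u) - delta.
  by move: Gu; rewrite /Gm le_max (leNgt u 0) u00 orbF.
have rk : rho u <= rho (k0.+1%:R / m%:R).
  have /andP[_ k0d] := kdiv k0m; apply: rle => //.
  by apply: le_trans Uu _; rewrite ler_pdivlMr// [leLHS]mulrC.
have k01 : (1 <= k0.+1 <= m)%N by [].
have := hc _ k01; have /andP[_ h1] := nnu1 k0m.
have : (cnt k0.+1)%:R <= k0%:R :> R by rewrite ler_nat.
move: uk; rewrite ltr_pdivrMr// bE.
have : m%:R * u <= m%:R * (GDU zeta (rho u) - delta) by rewrite ler_wpM2l// ltW.
have := GDU_le rk; rewrite /GDU.
set r := rho (_ / _) in h1 *; set r' := rho u => e0 e1 e2 e3 e4.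
have : m%:R * (1 - zeta + zeta * r') <= m%:R * (1 - zeta + zeta * r) by rewrite ler_wpM2l// ltW.
move: e1 e2 e3 e4 h1; slra.
Qed.

Lemma minus_inf : tau <= Gm (rho tau) ->
  forall cnt K dv, isK m lam cnt K -> cntrel cnt 1 dv ->
  K%:R / m%:R < Ucal rho tau Gm -> exists k0, (1 <= k0 <= m)%N /\ b <= - dv k0.
Proof.
move=> h cnt K dv [Km hK] hc UK.
have /andP[U1 U2] := Ucal_inf_bnd r01 tau01 range_Gm h.
have KmU : (K < m)%N.
  rewrite -(ltr_nat R); move: (lt_le_trans UK U2); by rewrite ltr_pdivrMr// mul1r.
have [k [k1 kc Gk]] : exists k, [/\ (1 <= k <= m)%N, (cnt k < k)%N &
    (cnt k)%:R <= m%:R * (GDU zeta (rho (k%:R / m%:R)) - delta)].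
  case: hK => [[lK _ hk]|[Kl _ hk]].
    exists K.+1; split=> //; first exact: hk.
    have Kt : tau <= K%:R / m%:R by rewrite /tau ler_pM2r ?invr_gt0// ler_nat.
    have := Ucal_inf_below r01 tau01 range_Gm h Kt UK.
    have /andP[K0 _] := kdiv (ltnW KmU).
    rewrite /Gm lt_max (ltNge _ 0) K0 orbF ltr_pdivrMr// => GK.
    apply: le_trans (_ : K%:R <= _); first by rewrite ler_nat hk.
    apply: ltW; apply: lt_le_trans GK _; rewrite [leRHS]mulrC ler_wpM2r ?(ltW mR0)// lerD2r GDU_le//.
    have /andP[_ Kd] := kdiv KmU; apply: rle => //.
    by rewrite ler_pM2r ?invr_gt0// ler_nat.
  have cl : (cnt lam < lam)%N by apply: hk; rewrite Kl leqnn.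
  exists lam; split=> //.
  apply: le_trans (_ : lam%:R <= _); first by rewrite ler_nat ltnW.
  have t0 : 0 < tau by rewrite divr_gt0// ltr0n; case/andP: lm.
  by move: h; rewrite /Gm le_max (leNgt tau 0) t0 orbF /tau ler_pdivrMr// mulrC.
have km : (k <= m)%N by case/andP: k1.
exists k; split=> //.
have := hc _ k1; have /andP[_ h1] := nnu1 km.
move: Gk; rewrite bE /GDU; move: h1; set r := rho _; slra.
Qed.

End Events.

(** * The fixed mixture model on cells *)

Section CellWeights.
Context {R : realType} {m : nat}.
Implicit Types (t : nat -> R) (F : R -> R).

(* Cell [a] stands for the interval (t_a, t_(a+1)], the first and last cells being
   unbounded, so that [p <= t k] iff the cell of [p] is [< k] for [1 <= k <= m]. *)
Definition cellcdf t F (k : nat) : R :=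
  if k is 0%N then 0 else if (k <= m)%N then F (t k) else 1.

Definition cellw t F (a : 'I_m.+1) : R := cellcdf t F a.+1 - cellcdf t F a.

Definition wFM t (m0 : nat) F (i : 'I_m) : 'I_m.+1 -> R :=
  if (i < m0)%N then cellw t id else cellw t F.

Lemma cumul_cellw t F (k : nat) : (k <= m.+1)%N -> cumul (cellw t F) k = cellcdf t F k.
Proof.
move=> km; rewrite /cumul.
rewrite (big_ord_narrow km)/= -(big_mkord xpredT (fun a => cellcdf t F a.+1 - cellcdf t F a)).
by rewrite telescope_sumr//= subr0.
Qed.

Lemma cellw_pmf t F : (forall k, (1 <= k <= m)%N -> 0 <= F (t k) <= 1) ->
  (forall j k, (1 <= j)%N -> (j <= k)%N -> (k <= m)%N -> F (t j) <= F (t k)) ->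
  is_pmf (cellw t F).
Proof.
move=> F01 Fle; split; last first.
  transitivity (cumul (cellw t F) m.+1).
    by apply: eq_bigl => a; rewrite ltn_ord.
  by rewrite cumul_cellw//= ltnn.
move=> a; rewrite /cellw subr_ge0 /cellcdf; have am := ltn_ord a; rewrite ltnS in am.
case: (nat_of_ord a) am => [_|k km].
  by case: ifP => // h; have /andP[] := F01 1%N h.
rewrite km; case: ifP => h; first exact: Fle.
by have /andP[] := F01 k.+1 km.
Qed.

Lemma cellw1 t (a : 'I_m.+1) : cellw t (fun=> 1) a = (a == ord0)%:R.
Proof.
rewrite /cellw /cellcdf -(inj_eq val_inj)/=; have am := ltn_ord a; rewrite ltnS in am.
case: (nat_of_ord a) am => [_|k km]; first by rewrite if_same subr0.
by rewrite km if_same subrr.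
Qed.

End CellWeights.

Section Domination.
Context {R : realType} {I : finType} {M : nat}.

Lemma Ex_dirac_le (w : I -> 'I_M.+1 -> R) (f : {ffun I -> 'I_M.+1} -> R) (s : seq I) :
  (forall i, is_pmf (w i)) -> (forall c j, f c <= f (upd c j ord0)) ->
  Ex w f <= Ex (fun i => if i \in s then fun a => (a == ord0)%:R else w i) f.
Proof.
move=> wP fle; elim: s => [|j s IH]; first by [].
apply: le_trans IH _.
set w' := fun i => _.
have w'P i : is_pmf (w' i).
  rewrite /w'; case: ifP => // _; split; first by move=> a; rewrite ler0n.
  by rewrite (bigD1 ord0)//= big1 ?addr0// => a /negbTE ->.
have dE : Ex (fun i => if i \in j :: s then fun a => (a == ord0)%:R else w i) f =
    Ex (fun i => if i == j then fun a => (a == ord0)%:R else w' i) f.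
  apply: eq_bigr => c _; congr (_ * _); apply: eq_bigr => i _.
  by rewrite inE /w'; case: eqVneq.
rewrite dE -Ex_resample; last by case: (w'P j).
apply: Ex_le => [i a|c _]; first by case: (w'P i).
rewrite (bigD1 ord0)//= mul1r big1 ?addr0//.
by move=> a /negbTE ->; rewrite mul0r.
Qed.

End Domination.

Section Fixed.
Context {R : realType} (rho : R -> R) (m lam : nat) (zeta delta : R).
Context (m2 : (2 <= m)%N) (lm : (1 <= lam <= m)%N).
Context (r01 : forall x : R, 0 <= x <= 1 -> 0 <= rho x <= 1).
Context (rle : forall x y : R, 0 <= x -> x <= y -> y <= 1 -> rho x <= rho y).
Context (rst : forall x y : R, 0 < x -> x <= y -> y <= 1 -> rho x / x <= rho y / y).
Context (z0 : 0 < zeta) (z1 : zeta < 1) (d0 : 0 < delta) (d1 : delta < 1).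

Let t : nat -> R := thr rho m.

Let m0R : 0 < (m%:R : R). Proof. by rewrite ltr0n; apply: leq_trans m2. Qed.

Lemma rho_le_id x : 0 <= x <= 1 -> rho x <= x.
Proof.
have pos y : 0 < y -> y <= 1 -> rho y <= y.
  move=> y0 y1; have := rst y0 y1 (lexx 1); rewrite divr1 ler_pdivrMr// => /le_trans; apply.
  rewrite ler_piMl ?(ltW y0)//.
  have z : 0 <= (1 : R) <= 1 by rewrite ler01 lexx.
  by have /andP[] := r01 z.
move=> /andP[]; rewrite le_eqVlt => /orP[/eqP <- _|]; last exact: pos.
rewrite leNgt; apply/negP => h.
pose y := Num.min (rho 0 / 2) 1.
have y0 : 0 < y by rewrite lt_min ltr01 divr_gt0.
have y1 : y <= 1 by rewrite ge_min lexx orbT.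
have := pos _ y0 y1; have := rle (lexx 0) (ltW y0) y1.
have : y <= rho 0 / 2 by rewrite ge_min lexx.
by move: h; lra.
Qed.

Lemma rho0 : rho 0 = 0.
Proof.
have z : 0 <= (0 : R) <= 1 by rewrite ler01 lexx.
by apply/eqP; rewrite eq_le rho_le_id//; have /andP[] := r01 z.
Qed.

Lemma thrE k : t k = rho (k%:R / m%:R).
Proof. by case: k => [|k] //; rewrite mul0r rho0. Qed.

Let kdiv (k : nat) : (k <= m)%N -> 0 <= (k%:R / m%:R : R) <= 1.
Proof. by move=> km; rewrite divr_ge0//= ler_pdivrMr// mul1r ler_nat. Qed.

Lemma thr01 k : (k <= m)%N -> 0 <= t k <= 1.
Proof. by move=> km; rewrite thrE; apply: r01; apply: kdiv. Qed.

Lemma thr_le j k : (j <= k)%N -> (k <= m)%N -> t j <= t k.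
Proof.
move=> jk km; rewrite !thrE; apply: rle.
- by have /andP[] := kdiv (leq_trans jk km).
- by rewrite ler_pM2r ?invr_gt0// ler_nat.
- by have /andP[] := kdiv km.
Qed.

Lemma thr_div_le j k : (1 <= j)%N -> (j <= k)%N -> (k <= m)%N ->
  t j / j%:R <= t k / k%:R.
Proof.
move=> j1 jk km; have j0 : 0 < (j%:R : R) by rewrite ltr0n.
have k0 : 0 < (k%:R : R) by rewrite ltr0n (leq_trans j1).
have e (x : R) : x / j%:R = m%:R^-1 * (x / (j%:R / m%:R)) by field; rewrite !gt_eqF.
have e' (x : R) : x / k%:R = m%:R^-1 * (x / (k%:R / m%:R)) by field; rewrite !gt_eqF.
rewrite e e' ler_pM2l ?invr_gt0// !thrE; apply: rst.
- by rewrite divr_gt0.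
- by rewrite ler_pM2r ?invr_gt0// ler_nat.
- by have /andP[] := kdiv km.
Qed.

Let u : 'I_m.+1 -> R := cellw t id.

Lemma u_pmf : is_pmf u.
Proof.
apply: cellw_pmf => [k /andP[_ km]|j k _ jk km]; first exact: thr01.
exact: thr_le.
Qed.

Lemma cumul_u k : (k <= m)%N -> cumul u k = t k.
Proof.
move=> km; rewrite cumul_cellw ?leqW// /cellcdf.
by case: k km => [|k] // ->.
Qed.

Lemma wFM_pmf m0 F : (forall k, (1 <= k <= m)%N -> 0 <= F (t k) <= 1) ->
  (forall j k, (1 <= j)%N -> (j <= k)%N -> (k <= m)%N -> F (t j) <= F (t k)) ->
  forall i, is_pmf (@wFM R m t m0 F i).
Proof.
move=> F01 Fle i; rewrite /wFM; case: ifP => _; first exact: u_pmf.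
exact: cellw_pmf.
Qed.

Lemma wDU_pmf m0 i : is_pmf (@wFM R m t m0 (fun=> 1) i).
Proof. by apply: wFM_pmf => *; rewrite ?ler01 ?lexx. Qed.

Implicit Type c : {ffun 'I_m -> 'I_m.+1}.

Let K c := khat m lam (cnt c).
Let K0 (i : 'I_m) c := K (upd c i ord0).
Let K1 (i : 'I_m) c := K (upd c i ord_max).

Lemma K_le_m c : (K c <= m)%N.
Proof. by case: (khatP (cnt c) lm). Qed.

Lemma K_anti c c' : (forall j, (c' j <= c j)%N) -> (K c <= K c')%N.
Proof. by move=> h; apply: khat_le => // k _; apply: cnt_anti. Qed.

Lemma K0_gt0 i c : (0 < K0 i c)%N.
Proof.
rewrite lt0n; apply/negP => /eqP e.
have := khatP (cnt (upd c i ord0)) lm; rewrite -/(K _) -/(K0 i c) e.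
case=> _ [[l0 _ _]|[_ _ /(_ 1%N)]]; first by move: (lm); lia.
have lm1 : (0 < 1 <= lam)%N by move: (lm); lia.
move=> /(_ lm1); rewrite ltnS leqn0 cards_eq0 => /eqP h.
have : i \in [set j | (upd c i ord0 j < 1)%N]%SET by rewrite inE ffunE eqxx.
by rewrite h inE.
Qed.

Lemma updd c (i : 'I_m) a b : upd (upd c i a) i b = upd c i b.
Proof. by apply/ffunP => j; rewrite !ffunE; case: eqP. Qed.

Lemma K_K0 i c : (K c <= K0 i c)%N.
Proof. by apply: K_anti => j; rewrite ffunE; case: ifP. Qed.

Lemma K1_K i c : (K1 i c <= K c)%N.
Proof. by apply: K_anti => j; rewrite ffunE; case: ifP => // _; rewrite -ltnS ltn_ord. Qed.

Let term (i : 'I_m) c : R := (c i < K c)%N%:R / (maxn (K c) 1)%:R.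

Lemma sum_u_lt k : (k <= m)%N -> \sum_a u a * (a < k)%N%:R = t k.
Proof.
move=> km; rewrite -cumul_u// /cumul big_mkcond [RHS]big_mkcond/=.
by apply: eq_bigr => a _; case: ifP => _; rewrite ?mulr1 ?mulr0.
Qed.

Lemma term_upper (w : 'I_m -> 'I_m.+1 -> R) i : (forall j, is_pmf (w j)) -> w i = u ->
  Ex w (term i) <= Ex w (fun c => t (K0 i c) / (K0 i c)%:R).
Proof.
move=> wP wi.
apply: (@le_trans _ _ (Ex w (fun c => (c i < K0 i c)%N%:R / (K0 i c)%:R))).
  apply: Ex_le => [j a|c _]; first by case: (wP j).
  rewrite /term; case: (boolP (c i < K c)%N) => h; last first.
    by rewrite mul0r divr_ge0.
  have e : K0 i c = K c by exact: khat_upd0.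
  by rewrite e h (maxn_idPl _)//; lia.
rewrite -(Ex_resample_id (j := i)); last by case: (wP i).
rewrite le_eqVlt; apply/orP; left; apply/eqP; apply: Ex_eq => c.
have h a : K0 i (upd c i a) = K0 i c by rewrite /K0 updd.
under eq_bigr do rewrite h ffunE eqxx mulrA.
by rewrite -mulr_suml wi sum_u_lt ?K_le_m.
Qed.

Lemma term_lower (w : 'I_m -> 'I_m.+1 -> R) i : (forall j, is_pmf (w j)) -> w i = u ->
  Ex w (fun c => t (K1 i c) / (K0 i c)%:R) <= Ex w (term i).
Proof.
move=> wP wi.
apply: (@le_trans _ _ (Ex w (fun c => (c i < K1 i c)%N%:R / (K0 i c)%:R))); last first.
  apply: Ex_le => [j a|c _]; first by case: (wP j).
  rewrite /term; case: (boolP (c i < K1 i c)%N) => h; last first.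
    by rewrite mul0r divr_ge0.
  have ciK : (c i < K c)%N by exact: leq_trans h (K1_K _ _).
  rewrite ciK (maxn_idPl _); last by lia.
  rewrite ler_pM2l// lef_pV2 ?posrE ?ltr0n ?K0_gt0//; last by lia.
  by rewrite ler_nat K_K0.
rewrite -[leRHS](Ex_resample_id (j := i)); last by case: (wP i).
rewrite le_eqVlt; apply/orP; left; apply/eqP; apply: Ex_eq => c.
have h a : K0 i (upd c i a) = K0 i c by rewrite /K0 updd.
have h1 a : K1 i (upd c i a) = K1 i c by rewrite /K1 updd.
under eq_bigr do rewrite h h1 ffunE eqxx mulrA.
by rewrite -mulr_suml wi sum_u_lt ?K_le_m.
Qed.

Lemma DU_worst m0 F i : (forall j, is_pmf (@wFM R m t m0 F j)) ->
  Ex (wFM t m0 F) (fun c => t (K0 i c) / (K0 i c)%:R) <=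
  Ex (wFM t m0 (fun=> 1)) (fun c => t (K0 i c) / (K0 i c)%:R).
Proof.
move=> wP; pose f c := t (K0 i c) / (K0 i c)%:R.
have fle c j : f c <= f (upd c j ord0).
  apply: thr_div_le; [exact: K0_gt0| |exact: K_le_m].
  by apply: K_anti => k; rewrite !ffunE; case: ifP => //; case: ifP.
apply: le_trans (Ex_dirac_le [seq j : 'I_m <- enum 'I_m | ~~ (j < m0)%N] wP fle) _.
rewrite le_eqVlt; apply/orP; left; apply/eqP.
apply: eq_bigr => c _; congr (_ * _); apply: eq_bigr => j _.
rewrite mem_filter mem_enum andbT /wFM.
by case: ifPn => [/negbTE ->|/negbNE ->]; rewrite ?cellw1.
Qed.


Let tau : R := lam%:R / m%:R.
Let Gp (x : R) : R := Num.min (GDU zeta x + delta) 1.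
Let Gm (x : R) : R := Num.max (GDU zeta x - delta) 0.
Let up := Ucal rho tau Gp.
Let um := Ucal rho tau Gm.

Section Concentration.
Context (m0 : nat) (m0m : (0 < m0 < m)%N) (i : 'I_m) (im0 : (i < m0)%N).
Context (nu : R) (nnu : `|m0.-1%:R - m%:R * zeta| <= m%:R * nu).

Let w := @wFM R m t m0 (fun=> 1).
Let D : {set 'I_m} := [set j : 'I_m | (j < m0)%N && (j != i)]%SET.
Let b : R := m%:R * (delta - nu - 1 / m%:R).

Lemma cardD : #|D| = m0.-1.
Proof.
have /andP[m00 m0m'] := m0m.
have -> : D = ([set j : 'I_m | (j < m0)%N] :\ i)%SET.
  by apply/setP => j; rewrite !inE andbC.
have := cardsD1 i [set j : 'I_m | (j < m0)%N]%SET; rewrite inE im0.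
have -> : #|[set j : 'I_m | (j < m0)%N]%SET| = m0.
  rewrite -sum1_card (eq_bigl (fun j : 'I_m => (j < m0)%N)); last by move=> j; rewrite inE.
  by rewrite (big_ord_narrow (ltnW m0m'))/= sum_nat_const card_ord muln1.
by rewrite add1n => /(congr1 predn)/= <-.
Qed.

Lemma support_alt c : (forall j, w j (c j) != 0) -> forall j : 'I_m, (m0 <= j)%N -> c j = ord0.
Proof.
move=> h j jm0; have := h j; rewrite /w /wFM ltnNge jm0/= cellw1.
by case: (eqVneq (c j) ord0) => // _; rewrite eqxx.
Qed.

Lemma cntE c' k : (@cnt m c' k)%:R = \sum_j (c' j < k)%N%:R :> R.
Proof.
rewrite /cnt -sum1_card natr_sum big_mkcond/=.
by apply: eq_bigr => j _; rewrite inE; case: ifP.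
Qed.

Lemma cntrel_upd c (a : 'I_m.+1) (off : R) : (forall j, w j (c j) != 0) ->
  (forall k, (1 <= k <= m)%N -> 1 - (a < k)%N%:R = off) ->
  cntrel rho m m0.-1 (cnt (upd c i a)) off (fun k => dev D u k c).
Proof.
move=> sc offE k km; have kM : (k <= m)%N by case/andP: km.
rewrite cntE -(offE k km) /dev cumul_u// -thrE.
have -> : \sum_(j in D) ((c j < k)%N%:R - t k) = \sum_(j in D) (c j < k)%N%:R - m0.-1%:R * t k.
  by rewrite sumrB sumr_const cardD mulr_natl.
rewrite (bigID (mem D))/=.
have -> : \sum_(j in D) (upd c i a j < k)%N%:R = \sum_(j in D) (c j < k)%N%:R :> R.
  by apply: eq_bigr => j; rewrite inE => /andP[_ /negbTE ji]; rewrite ffunE ji.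
have -> : \sum_(j | j \notin D) (upd c i a j < k)%N%:R = m%:R - m0.-1%:R - 1 + (a < k)%N%:R :> R.
  have iD : i \notin D by rewrite inE eqxx andbF.
  rewrite (bigD1 i)//= ffunE eqxx.
  rewrite (eq_bigr (fun=> 1)); last first.
    move=> j /andP[jD ji]; rewrite ffunE (negbTE ji).
    move: jD; rewrite inE ji andbT -leqNgt => jm0.
    by rewrite (support_alt sc jm0)/=; case/andP: km => ->.
  have -> : \sum_(j | (j \notin D) && (j != i)) (1 : R) = m%:R - m0.-1%:R - 1.
    have : \sum_(j : 'I_m) (1 : R) = m%:R by rewrite sumr_const card_ord.
    rewrite (bigID (mem D))/= sumr_const cardD (bigD1 i)//= => <-; ring.
  by ring.
by ring.
Qed.

Lemma cntrel0 c : (forall j, w j (c j) != 0) ->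
  cntrel rho m m0.-1 (cnt (upd c i ord0)) 0 (fun k => dev D u k c).
Proof. by move=> sc; apply: cntrel_upd => // k /andP[-> _]; rewrite subrr. Qed.

Lemma cntrel1 c : (forall j, w j (c j) != 0) ->
  cntrel rho m m0.-1 (cnt (upd c i ord_max)) 1 (fun k => dev D u k c).
Proof.
by move=> sc; apply: cntrel_upd => // k /andP[_ km]; rewrite /= ltnNge km subr0.
Qed.

Lemma wD j : j \in D -> w j = u.
Proof. by rewrite inE /w /wFM => /andP[-> _]. Qed.

(* At most one of the two deviations needs the maximal inequality (2J blocks): the
   other one, or both, is a deviation at a single deterministic index. *)
Lemma bad_prob (J : nat) : 0 < delta - nu - 1 / m%:R -> 0 <= nu ->
  zeta ^+ J <= 4^-1 -> J.*2%:R + 1 <= 4 / (1 - zeta) ->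
  Ex w (fun c => (up < (K0 i c)%:R / m%:R)%R%:R) +
  Ex w (fun c => ((K1 i c)%:R / m%:R < um)%R%:R) <=
  4 / (1 - zeta) * expR (- (zeta * (2 * b ^+ 2 / (m%:R * (zeta + nu))))).
Proof.
move=> e0 nu0 zJ J4.
have wP : forall j, is_pmf (w j) by move=> j; exact: wDU_pmf.
have w0 j a : 0 <= w j a by case: (wP j).
set v := m%:R * (zeta + nu).
have v0 : 0 < v by rewrite mulr_gt0// ltr_wpDr.
have Dv : #|D|%:R <= v.
  by rewrite cardD /v mulrDr; move: (nnu); rewrite ler_norml => /andP[_]; lra.
have b0 : 0 <= b by rewrite mulr_ge0// ltW.
set X := expR _.
have E0 : 0 <= 2 * b ^+ 2 / v by rewrite divr_ge0 ?(ltW v0)// mulr_ge0// sqr_ge0.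
have one k (sg : R) : sg ^+ 2 = 1 -> Ex w (fun c => ((b <= sg * dev D u k c)%R)%:R) <= X.
  move=> sg1; apply: le_trans (dev_tail k wP u_pmf wD sg1 b0 v0 Dv) _.
  by rewrite ler_expR lerN2 ler_piMl// ltW.
have sup (sg : R) : sg ^+ 2 = 1 ->
    Ex w (fun c => [exists k : 'I_m.+1, (0 < k)%N && (b <= sg * dev D u k c)%R]%:R) <=
    J.*2%:R * X.
  by move=> sg1; exact: (sup_tail wP u_pmf wD sg1 b0 (ltW z0) v0 Dv zJ).
have X0 : 0 <= X by exact: expR_ge0.
have z4 : 4 <= 4 / (1 - zeta).
  by rewrite ler_pdivlMr ?subr_gt0// ler_piMr// gerBl ltW.
have bX : (J.*2%:R + 1) * X <= 4 / (1 - zeta) * X by rewrite ler_wpM2r.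
have bX4 : 4 * X <= 4 / (1 - zeta) * X by rewrite ler_wpM2r.
have s1 : 1 ^+ 2 = 1 :> R by rewrite expr1n.
have sN1 : (- 1) ^+ 2 = 1 :> R by rewrite sqrrN expr1n.
have mm : (0 < m)%N by apply: leq_trans m2.
have isK0 c : isK m lam (cnt (upd c i ord0)) (K0 i c) by exact: khatP.
have isK1 c : isK m lam (cnt (upd c i ord_max)) (K1 i c) by exact: khatP.
have pone : tau <= Gp (rho tau) ->
    Ex w (fun c => (up < (K0 i c)%:R / m%:R)%R%:R) <= X.
  move=> h; have [k0 [_ hk0]] := plus_inf mm lm r01 rle z0 z1 d0 d1 nnu h.
  apply: le_trans (one k0 1 s1); apply: Ex_le => // c sc.
  rewrite ler_nat; case: (boolP (up < _)%R) => //= hup.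
  by rewrite mul1r (hk0 _ _ _ (isK0 c) (cntrel0 sc) hup).
have mone : Gm (rho tau) < tau ->
    Ex w (fun c => ((K1 i c)%:R / m%:R < um)%R%:R) <= X.
  move=> h; have [k0 [_ hk0]] := minus_sup mm lm r01 rle z0 z1 d0 d1 nnu h.
  apply: le_trans (one k0 (-1) sN1); apply: Ex_le => // c sc.
  rewrite ler_nat; case: (boolP (_ < um)%R) => //= hup.
  by rewrite mulN1r (hk0 _ _ _ (isK1 c) (cntrel1 sc) hup).
have psup : Gp (rho tau) < tau ->
    Ex w (fun c => (up < (K0 i c)%:R / m%:R)%R%:R) <= J.*2%:R * X.
  move=> h; apply: le_trans (sup 1 s1); apply: Ex_le => // c sc.
  rewrite ler_nat; case: (boolP (up < _)%R) => //= hup.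
  have [k0 [/andP[k01 k0m] hk0]] :=
    plus_sup mm lm r01 z0 z1 d0 d1 nnu h (isK0 c) (cntrel0 sc) hup.
  have -> // : [exists k : 'I_m.+1, (0 < k)%N && (b <= 1 * dev D u k c)%R].
  apply/existsP; exists (inord k0); rewrite inordK ?ltnS//.
  by rewrite k01 mul1r.
have msup : tau <= Gm (rho tau) ->
    Ex w (fun c => ((K1 i c)%:R / m%:R < um)%R%:R) <= J.*2%:R * X.
  move=> h; apply: le_trans (sup (-1) sN1); apply: Ex_le => // c sc.
  rewrite ler_nat; case: (boolP (_ < um)%R) => //= hup.
  have [k0 [/andP[k01 k0m] hk0]] :=
    minus_inf mm lm r01 rle z0 z1 d0 d1 nnu h (isK1 c) (cntrel1 sc) hup.
  have -> // : [exists k : 'I_m.+1, (0 < k)%N && (b <= -1 * dev D u k c)%R].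
  apply/existsP; exists (inord k0); rewrite inordK ?ltnS//.
  by rewrite k01 mulN1r.
have tau01 : 0 <= tau <= 1 by apply: kdiv; case/andP: lm.
have GG : Gm (rho tau) <= Gp (rho tau) by apply: GmGp => //; apply: r01.
have [hm|hm] := leP tau (Gm (rho tau)).
  have h1 := pone (le_trans hm GG); have h2 := msup hm.
  by apply: le_trans (lerD h1 h2) _; move: bX; lra.
have h2 := mone hm; have [hp|hp] := leP tau (Gp (rho tau)).
  by apply: le_trans (lerD (pone hp) h2) _; move: bX4 X0; lra.
by apply: le_trans (lerD (psup hp) h2) _; move: bX; lra.
Qed.

End Concentration.

Let tau01 : 0 <= tau <= 1.
Proof. by apply: kdiv; case/andP: lm. Qed.

Let um0 : 0 <= um.
Proof. by have /andP[] := Ucal_bnd r01 tau01 (range_Gm z0 z1 d0 d1). Qed.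

Let up1 : up <= 1.
Proof. by have /andP[] := Ucal_bnd r01 tau01 (range_Gp z0 z1 d0 d1). Qed.

Let umup : um <= up.
Proof.
apply: (Ucal_le r01 tau01); [exact: range_Gm|exact: range_Gp|].
by move=> x; exact: GmGp.
Qed.

Let gap_ge0 : 0 <= (rho up - rho um) / up.
Proof. by rewrite divr_ge0 ?subr_ge0 ?(le_trans um0 umup)// rle. Qed.

(* K0 and K1 sandwich K, so the loss between the upper bound for F and the lower
   bound for the Dirac-uniform configuration is (t_K0 - t_K1) / K0. *)
Lemma gap_bound i c : t (K0 i c) / (K0 i c)%:R - t (K1 i c) / (K0 i c)%:R <=
  m%:R^-1 * ((rho up - rho um) / up + ((up < (K0 i c)%:R / m%:R)%R%:R +
                                       ((K1 i c)%:R / m%:R < um)%R%:R)).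
Proof.
have K0p : 0 < (K0 i c)%:R :> R by rewrite ltr0n K0_gt0.
have K0m := K_le_m (upd c i ord0); have K1m := K_le_m (upd c i ord_max).
have /andP[x0p x0l] := kdiv K0m; have /andP[x1p x1l] := kdiv K1m.
have x0pp : 0 < (K0 i c)%:R / m%:R :> R by rewrite divr_gt0.
rewrite -mulrBl.
have -> : (t (K0 i c) - t (K1 i c)) / (K0 i c)%:R =
    m%:R^-1 * ((t (K0 i c) - t (K1 i c)) / ((K0 i c)%:R / m%:R)).
  by field; rewrite !gt_eqF.
rewrite ler_pM2l ?invr_gt0//.
have bad : (t (K0 i c) - t (K1 i c)) / ((K0 i c)%:R / m%:R) <= 1.
  rewrite ler_pdivrMr// mul1r; apply: (@le_trans _ _ (t (K0 i c))).
    by rewrite gerBl; have /andP[] := thr01 K1m.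
  by rewrite thrE; apply: rho_le_id; rewrite x0p.
have g0 := gap_ge0.
have [hp|hp] := ltP up ((K0 i c)%:R / m%:R).
  by apply: le_trans bad _; rewrite addrCA lerDl addr_ge0.
have [hm|hm] := ltP ((K1 i c)%:R / m%:R) um.
  by apply: le_trans bad _; rewrite add0r lerDr.
rewrite !addr0 !mulrBl; apply: lerB; first by rewrite thrE rst.
have upp : 0 < up by apply: lt_le_trans hp.
apply: ler_pM.
- have um01 : 0 <= um <= 1 by rewrite um0 (le_trans umup).
  by have /andP[] := r01 um01.
- by rewrite invr_ge0 ltW.
- by rewrite thrE rle.
- by rewrite lef_pV2 ?posrE.
Qed.

Lemma eps_exp_le (nu : R) : 0 <= nu -> 0 < delta - nu - 1 / m%:R -> nu < zeta ->
  expR (- (zeta * (2 * (m%:R * (delta - nu - 1 / m%:R)) ^+ 2 / (m%:R * (zeta + nu))))) <=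
  expR (- (2 * m%:R) * (Num.max 0 (delta - nu - 1 / m%:R)) ^+ 2 * Num.max 0 (1 - nu / zeta)).
Proof.
move=> nu0 e0 nz; rewrite ler_expR.
rewrite (max_idPr (ltW e0)); set e := delta - nu - _ in e0 *.
have zn : 0 < zeta + nu by rewrite ltr_wpDr.
have nz1 : 0 <= 1 - nu / zeta by rewrite subr_ge0 ler_pdivrMr// mul1r ltW.
rewrite (max_idPr nz1) mulNr mulNr lerN2.
have -> : zeta * (2 * (m%:R * e) ^+ 2 / (m%:R * (zeta + nu))) =
   2 * m%:R * e ^+ 2 * (zeta / (zeta + nu)) by field; rewrite !gt_eqF.
have c0 : 0 <= 2 * m%:R * e ^+ 2 :> R by rewrite mulr_ge0 ?sqr_ge0// mulr_ge0.
apply: (ler_wpM2l c0); rewrite ler_pdivlMr//.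
have -> : (1 - nu / zeta) * (zeta + nu) = zeta - nu ^+ 2 / zeta by field; rewrite gt_eqF.
by rewrite gerBl divr_ge0 ?sqr_ge0// ltW.
Qed.

Lemma gap_Ex m0 (i : 'I_m) (nu : R) : (0 < m0 < m)%N -> (i < m0)%N -> 0 <= nu ->
  `|m0.-1%:R - m%:R * zeta| <= m%:R * nu ->
  Ex (wFM t m0 (fun=> 1)) (fun c => t (K0 i c) / (K0 i c)%:R - t (K1 i c) / (K0 i c)%:R) <=
  m%:R^-1 * eps_bound rho m lam zeta delta nu.
Proof.
move=> m0m im0 nu0 nnu; set w := wFM _ _ _.
have wP : forall j, is_pmf (w j) by move=> j; exact: wDU_pmf.
have w0 j a : 0 <= w j a by case: (wP j).
apply: le_trans (Ex_le w0 (fun c _ => gap_bound i c)) _.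
rewrite ExZ ler_pM2l ?invr_gt0// ExD Ex_cst// ExD /eps_bound lerD2l.
have z4 : 4 <= 4 / (1 - zeta).
  by rewrite ler_pdivlMr ?subr_gt0// ler_piMr// gerBl ltW.
have triv : Ex w (fun c => (up < (K0 i c)%:R / m%:R)%R%:R) +
    Ex w (fun c => ((K1 i c)%:R / m%:R < um)%R%:R) <= 4 / (1 - zeta).
  apply: le_trans (_ : 1 + 1 <= _); last by move: z4; lra.
  by apply: lerD; rewrite -[leRHS](Ex_cst 1 wP); apply: Ex_le => // c _;
    rewrite lern1 leq_b1.
have [e0|] := boolP (0 < delta - nu - 1 / m%:R); last first.
  rewrite -leNgt => e0; rewrite (max_idPl e0) expr0n mulr0 mul0r expR0 mulr1.
  exact: triv.
have [nz|] := boolP (nu < zeta); last first.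
  rewrite -leNgt => nz; rewrite (@max_idPl _ _ 0 (1 - nu / zeta) _) ?mulr0 ?expR0 ?mulr1//.
  by rewrite subr_le0 ler_pdivlMr// mul1r.
have z01 : 0 < zeta < 1 by rewrite z0 z1.
have [J [zJ J4]] := block_count z01.
apply: le_trans (bad_prob m0m im0 nnu e0 nu0 zJ J4) _.
by rewrite ler_wpM2l ?divr_ge0 ?subr_ge0 ?(ltW z1)// eps_exp_le.
Qed.

Lemma eps_ge0 (nu : R) : 0 <= eps_bound rho m lam zeta delta nu.
Proof.
rewrite /eps_bound; apply: addr_ge0; first exact: gap_ge0.
by rewrite mulr_ge0 ?expR_ge0// divr_ge0// subr_ge0 ltW.
Qed.

Lemma eps_mono (nu nu' : R) : nu <= nu' ->
  eps_bound rho m lam zeta delta nu <= eps_bound rho m lam zeta delta nu'.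
Proof.
move=> nn; rewrite /eps_bound lerD2l ler_wpM2l ?divr_ge0 ?subr_ge0 ?(ltW z1)//.
have mx (x y : R) : x <= y -> Num.max 0 x <= Num.max 0 y.
  by move=> xy; rewrite ge_max !le_max lexx xy orbT.
have mx0 (x : R) : 0 <= Num.max 0 x by rewrite le_max lexx.
rewrite ler_expR !mulNr lerN2; apply: ler_pM => //.
- by rewrite mulr_ge0 ?sqr_ge0// mulr_ge0.
- have m20 : 0 <= 2 * m%:R :> R by rewrite mulr_ge0.
  apply: (ler_wpM2l m20); rewrite ler_sqr ?nnegrE//; apply: mx.
  by rewrite lerD2r lerD2l lerN2.
- by apply: mx; rewrite lerD2l lerN2 ler_pM2r ?invr_gt0.
Qed.

Definition FDRd m0 F : R := Ex (@wFM R m t m0 F) (fdpd m0 lam).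

Lemma FDRd_sum m0 F : FDRd m0 F = \sum_(i < m | (i < m0)%N) Ex (wFM t m0 F) (term i).
Proof. exact: Ex_sum. Qed.

Lemma fixed_discrete m0 F : (0 < m0 < m)%N ->
  (forall k, (1 <= k <= m)%N -> 0 <= F (t k) <= 1) ->
  (forall j k, (1 <= j)%N -> (j <= k)%N -> (k <= m)%N -> F (t j) <= F (t k)) ->
  FDRd m0 F <= FDRd m0 (fun=> 1) + m0%:R / m%:R * eps_bound rho m lam zeta delta
     (Num.max `|m0.-1%:R / m%:R - zeta| `|m0%:R / m%:R - zeta|).
Proof.
move=> m0m F01 Fle; set nu := Num.max _ _.
have nu0 : 0 <= nu by rewrite le_max normr_ge0.
have nnu : `|m0.-1%:R - m%:R * zeta| <= m%:R * nu.
  have -> : m0.-1%:R - m%:R * zeta = m%:R * (m0.-1%:R / m%:R - zeta) :> R.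
    by field; rewrite gt_eqF.
  by rewrite normrM (gtr0_norm m0R) ler_pM2l// le_max lexx.
have wP := wFM_pmf m0 F01 Fle.
rewrite !FDRd_sum.
have -> : m0%:R / m%:R * eps_bound rho m lam zeta delta nu =
    \sum_(i < m | (i < m0)%N) m%:R^-1 * eps_bound rho m lam zeta delta nu.
  have /andP[_ m0m'] := m0m.
  by rewrite (big_ord_narrow (ltnW m0m'))/= sumr_const card_ord -mulrA mulr_natl.
rewrite -big_split/=; apply: ler_sum => i im0.
have wi G : wFM t m0 G i = u by rewrite /wFM im0.
apply: le_trans (term_upper wP (wi _)) _.
apply: le_trans (DU_worst _ wP) _.
have := gap_Ex m0m im0 nu0 nnu.
have := term_lower (wDU_pmf m0) (wi _).
have -> : Ex (wFM t m0 (fun=> 1)) (fun c => t (K0 i c) / (K0 i c)%:R - t (K1 i c) / (K0 i c)%:R) =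
  Ex (wFM t m0 (fun=> 1)) (fun c => t (K0 i c) / (K0 i c)%:R) -
  Ex (wFM t m0 (fun=> 1)) (fun c => t (K1 i c) / (K0 i c)%:R).
  by rewrite -[X in _ = _ - X]mul1r -mulNr -ExZ -ExD; apply: Ex_eq => c; rewrite mulN1r.
lra.
Qed.

Lemma fdpd_bnd m0 c : 0 <= (fdpd m0 lam c : R) <= 1.
Proof.
apply/andP; split; first by apply: sumr_ge0 => i _; rewrite divr_ge0.
rewrite /fdpd -mulr_suml -/(K c) ler_pdivrMr ?ltr0n ?leq_max ?orbT// mul1r.
rewrite -natr_sum ler_nat; apply: leq_trans (leq_maxl _ _).
rewrite -[leqRHS](khat_cnt c lm) -/(K c) /cnt -sum1_card big_mkcond [leqRHS]big_mkcond/=.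
by apply: leq_sum => i _; rewrite inE; do 2 case: ifP.
Qed.

End Fixed.

(** * Reduction of the models to cells *)

Section Discretization.
Context {R : realType} {d : measure_display} {T : measurableType d}.
Context (P : probability T R).

Lemma full_setI (A O : set T) : measurable A -> measurable O -> P O = 1%E ->
  P (A `&` O) = P A.
Proof.
move=> mA mO PO; rewrite [RHS](measureDI _ mA mO).
have mD : measurable (A `\` O) by exact: measurableD.
have mC : measurable (~` O) by exact: measurableC.
have AO : A `\` O `<=` ~` O by move=> x [].
have P0 : P (~` O) = 0%E by rewrite probability_setC// PO -EFinB subrr.
by rewrite (subset_measure0 mD mC AO P0) add0e.
Qed.

Lemma integral_fin (A : finType) (X : T -> A) (h : A -> R) :
  (forall a, measurable [set w | X w = a]) -> (forall a, 0 <= h a) ->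
  (\int[P]_w (h (X w))%:E = \sum_a (h a)%:E * P [set w | X w = a])%E.
Proof.
move=> mX h0.
have hE w : ((h (X w))%:E = \sum_(a : A) (h a)%:E * (\1_[set w | X w = a] w)%:E)%E.
  rewrite (bigD1 (X w))//= big1 => [|a aX]; last first.
    rewrite indicE memNset ?mule0// => /esym/eqP; exact/negP.
  by rewrite indicE mem_set// mule1 adde0.
under eq_integral do rewrite hE.
have mi a : measurable_fun setT (EFin \o (\1_[set w | X w = a] : T -> R)).
  by apply/measurable_EFinP; exact: measurable_indic.
rewrite ge0_integral_sum//=; last 2 first.
- by move=> a; apply: measurable_funeM; exact: mi.
- by move=> a w _; rewrite mule_ge0// lee_fin.
apply: eq_bigr => a _; rewrite ge0_integralZl_EFin//.
  by rewrite integral_indic// setIT.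
exact: mi.
Qed.

Context {m : nat} (p : 'I_m -> T -> R) (mp : forall i, measurable_fun setT (p i)).

Let mle i (x : R) : measurable [set w | p i w <= x].
Proof.
have := @mp i measurableT _ (measurable_itv `]-oo, x]).
by rewrite setTI; congr measurable; apply/seteqP; split => w /=; rewrite in_itv.
Qed.

Let mlt i (x : R) : measurable [set w | x < p i w].
Proof.
have := @mp i measurableT _ (measurable_itv `]x, +oo[).
by rewrite setTI; congr measurable; apply/seteqP; split => w /=; rewrite in_itv/= andbT.
Qed.

Let mall (Q : 'I_m -> T -> Prop) : (forall i, measurable [set w | Q i w]) ->
  measurable [set w | forall i, Q i w].
Proof.
move=> mQ; have -> : [set w | forall i, Q i w] = \bigcap_(i in [set: 'I_m]) [set w | Q i w].
  by apply/seteqP; split => w /= h i => [_|]; exact: h.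
by apply: fin_bigcap_measurable => //; exact: finite_finset.
Qed.

Definition box (s : seq 'I_m) (lo hi : 'I_m -> R) : set T :=
  [set w | forall i, p i w <= hi i /\ (i \in s -> lo i < p i w)].

Let mbox s lo hi : measurable (box s lo hi).
Proof.
apply: mall => i; case: (boolP (i \in s)) => si.
  rewrite [X in measurable X](_ : _ = [set w | p i w <= hi i] `&` [set w | lo i < p i w]).
    exact: measurableI.
  by apply/seteqP; split => w /= [h1 h2]; split => // ; apply: h2.
rewrite [X in measurable X](_ : _ = [set w | p i w <= hi i]) //.
by apply/seteqP; split => w /= => [[]|].
Qed.

Lemma box_prob (B : set T) (w0 : R) (G : 'I_m -> R -> R) : measurable B ->
  (forall x : 'I_m -> R,
    P (B `&` [set w | forall i, p i w <= x i]) = (w0 * \prod_i G i (x i))%:E) ->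
  forall s lo hi, (forall i, lo i <= hi i) ->
  P (B `&` box s lo hi) =
  (w0 * \prod_i (G i (hi i) - (if i \in s then G i (lo i) else 0)))%:E.
Proof.
move=> mB H; elim=> [|j s IH] lo hi lohi.
  rewrite (_ : box _ _ _ = [set w | forall i, p i w <= hi i]).
    by rewrite H; congr (_ * _)%:E; apply: eq_bigr => i _; rewrite subr0.
  by apply/seteqP; split => w /= h i; [case: (h i)|split].
have [js|js] := boolP (j \in s).
  have inE' i : (i \in j :: s) = (i \in s) by rewrite inE; case: eqVneq => // ->.
  rewrite (_ : box (j :: s) lo hi = box s lo hi).
    by rewrite IH//; congr (_ * _)%:E; apply: eq_bigr => i _; rewrite inE'.
  by rewrite /box; under eq_fun do under eq_forall do rewrite inE'.
pose hi' i := if i == j then lo j else hi i.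
have lohi' i : lo i <= hi' i by rewrite /hi'; case: eqVneq => // ->.
have -> : B `&` box (j :: s) lo hi = (B `&` box s lo hi) `\` (B `&` box s lo hi').
  apply/seteqP; split => w /=.
    move=> [Bw h]; split.
      by split=> // i; have [h1 h2] := h i; split=> // si; apply: h2; rewrite inE si orbT.
    move=> [_ h']; have [h1 _] := h' j; have [_ h2] := h j.
    move: h1; rewrite /hi' eqxx leNgt => /negP; apply; apply: h2.
    by rewrite inE eqxx.
  move=> [[Bw h] nh]; split=> // i; have [h1 h2] := h i; split=> //.
  rewrite inE => /orP[/eqP ->|]; last exact: h2.
  rewrite ltNge; apply/negP => pj; apply: nh; split=> // k; have [h3 h4] := h k.
  by split=> //; rewrite /hi'; case: eqVneq => // ->.
rewrite measureD//=; last 3 first.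
- exact: measurableI.
- exact: measurableI.
- by rewrite IH// ltry.
have -> : (B `&` box s lo hi) `&` (B `&` box s lo hi') = B `&` box s lo hi'.
  apply/seteqP; split => w /=; first by case.
  move=> [Bw h]; split=> //; split=> // i; have [h1 h2] := h i; split=> //.
  by apply: le_trans h1 _; rewrite /hi'; case: eqVneq => // ->.
rewrite !IH// -EFinB -mulrBr; congr (_ * _)%:E.
rewrite (bigD1 j)//= [X in _ - X](bigD1 j)//= [RHS](bigD1 j)//=.
have -> : \prod_(i | i != j) (G i (hi' i) - (if i \in s then G i (lo i) else 0)) =
          \prod_(i | i != j) (G i (hi i) - (if i \in s then G i (lo i) else 0)).
  by apply: eq_bigr => i /negbTE ij; rewrite /hi' ij.
have -> : \prod_(i | i != j) (G i (hi i) - (if i \in j :: s then G i (lo i) else 0)) =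
          \prod_(i | i != j) (G i (hi i) - (if i \in s then G i (lo i) else 0)).
  by apply: eq_bigr => i /negbTE ij; rewrite inE ij.
rewrite (negbTE js) inE eqxx /hi' eqxx/=; ring.
Qed.

Context (t : nat -> R) (t01 : forall k, (1 <= k <= m)%N -> 0 <= t k <= 1).
Context (tle : forall i j, (1 <= i)%N -> (i <= j)%N -> (j <= m)%N -> t i <= t j).

Lemma cellof_eq (x : R) (a : 'I_m.+1) : cellof t x = a <->
  ((a < m)%N -> x <= t a.+1) /\ ((0 < a)%N -> t a < x).
Proof.
have cP k := @cellofP R m t x k tle.
split=> [<-|[h1 h2]].
  split=> h; first by rewrite -cP.
  by rewrite ltNge -cP ?ltnn// h -ltnS ltn_ord.
apply/val_inj/eqP; rewrite /= eqn_leq; apply/andP; split.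
  have [am|am] := ltnP a m; last by apply: leq_trans am; rewrite -ltnS ltn_ord.
  by rewrite -ltnS cP// h1.
have [->//|a0] := posnP (nat_of_ord a).
have am : (0 < a <= m)%N by rewrite a0 -ltnS ltn_ord.
by rewrite leqNgt cP// -ltNge h2.
Qed.

Definition cells (w : T) : {ffun 'I_m -> 'I_m.+1} := [ffun i => cellof t (p i w)].

Lemma measurable_cells c : measurable [set w | cells w = c].
Proof.
have -> : [set w | cells w = c] = [set w | forall i, cellof t (p i w) = c i].
  apply/seteqP; split => w /=; first by move=> <- i; rewrite ffunE.
  by move=> h; apply/ffunP => i; rewrite ffunE.
apply: mall => i; set a := c i.
rewrite [X in measurable X](_ : _ =
   [set w | (a < m)%N -> p i w <= t a.+1] `&` [set w | (0 < a)%N -> t a < p i w]).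
  apply: measurableI.
    case: (ltnP a m) => am; last first.
      by rewrite [X in measurable X](_ : _ = setT)//; apply/seteqP; split.
    rewrite [X in measurable X](_ : _ = [set w | p i w <= t a.+1])//.
    by apply/seteqP; split => w /= h //; exact: h.
  case: (posnP a) => [a0|a0].
    by rewrite [X in measurable X](_ : _ = setT)//; apply/seteqP; split => // w _ /=.
  rewrite [X in measurable X](_ : _ = [set w | t a < p i w])//.
  by apply/seteqP; split => w /= h //; exact: h.
by apply/seteqP; split => w /= => [/cellof_eq//|h]; exact/cellof_eq.
Qed.

(* 2 lies beyond the support, so on this almost sure event every cell is a bounded box. *)
Definition inrange : set T := [set w | forall i, p i w <= 2].

Lemma measurable_inrange : measurable inrange.
Proof. exact: mall. Qed.

Lemma cell_prob (B : set T) (w0 : R) (m0 : nat) (F : R -> R) : measurable B ->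
  (forall x : 'I_m -> R,
    P (B `&` [set w | forall i, p i w <= x i]) =
      (w0 * \prod_i fm_cdf m0 F i (x i))%:E) ->
  forall c, P (B `&` inrange `&` [set w | cells w = c]) =
    (w0 * \prod_i wFM t m0 F i (c i))%:E.
Proof.
move=> mB H c.
pose hi i := if (c i < m)%N then t (c i).+1 else 2.
pose lo i := if (0 < c i)%N then t (c i) else 0.
pose s := [seq i <- enum 'I_m | (0 < c i)%N].
have sE i : (i \in s) = (0 < c i)%N by rewrite mem_filter mem_enum andbT.
have cm i : (c i <= m)%N by rewrite -ltnS ltn_ord.
have lohi i : lo i <= hi i.
  rewrite /lo /hi; case: ifP => c0; case: ifP => cim.
  - exact: tle.
  - have h : (1 <= c i <= m)%N by rewrite c0 cm.
    by have /andP[_] := t01 h; lra.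
  - by have /andP[] := t01 (k := (c i).+1) cim.
  - by lra.
have -> : B `&` inrange `&` [set w | cells w = c] = B `&` box s lo hi.
  rewrite -setIA; congr (_ `&` _); apply/seteqP; split => w /=.
    move=> [h2 hc] i; have /cellof_eq[h3 h4] : cellof t (p i w) = c i.
      by rewrite -hc ffunE.
    rewrite /hi /lo sE; split; last by move=> c0; rewrite c0; exact: h4.
    by case: ifP => // cim; exact: h3.
  move=> h; split.
    move=> i; have [h1 _] := h i; apply: le_trans h1 _; rewrite /hi; case: ifP => // cim.
    by have /andP[_] := t01 (k := (c i).+1) cim; lra.
  apply/ffunP => i; rewrite ffunE; apply/cellof_eq; have [h1 h2] := h i; split.
    by move=> cim; move: h1; rewrite /hi cim.
  by move=> c0; move: h2; rewrite sE /lo c0; apply.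
rewrite (box_prob mB H) //; congr (_ * _)%:E; apply: eq_bigr => i _.
have cdfE Fi k : (1 <= k <= m)%N -> cdf01 Fi (t k) = Fi (t k).
  by move=> /t01 /andP[tk0 tk1]; rewrite /cdf01 ltNge tk0 tk1.
have cdf2 Fi : cdf01 Fi 2 = 1 :> R.
  by rewrite /cdf01 ltNge ler0n/= leNgt ltr1n.
rewrite /fm_cdf /wFM sE /hi /lo /cellw /cellcdf.
have aux Fi : cdf01 Fi (if (c i < m)%N then t (c i).+1 else 2) -
    (if (0 < c i)%N then cdf01 Fi (if (0 < c i)%N then t (c i) else 0) else 0) =
    (if (c i < m)%N then Fi (t (c i).+1) else 1) -
    match nat_of_ord (c i) with 0%N => 0 | _.+1 => if (c i <= m)%N then Fi (t (c i)) else 1 end.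
  rewrite cm; congr (_ - _).
    by case: ifP => cim; rewrite ?cdf2 ?cdfE.
  case: (posnP (nat_of_ord (c i))) => [->//|c0].
  rewrite cdfE ?c0 ?cm//.
  by case: (nat_of_ord (c i)) c0.
by case: ifP => im0; rewrite aux; case: (nat_of_ord (c i)) (cm i) => [|k] // ->.
Qed.

End Discretization.

Section Binomial.
Context {R : realType} (m : nat) (zeta : R).
Context (z01 : 0 < zeta < 1).

Definition binw (k : nat) : R := 'C(m, k)%:R * zeta ^+ k * (1 - zeta) ^+ (m - k).

Lemma binw_ge0 k : 0 <= binw k.
Proof.
case/andP: z01 => /ltW z0 /ltW z1.
by rewrite !mulr_ge0 ?exprn_ge0 ?subr_ge0.
Qed.

Lemma binw_mgf (x y : R) : \sum_(k < m.+1) binw k * (x ^+ k * y ^+ (m - k)) =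
  (zeta * x + (1 - zeta) * y) ^+ m.
Proof.
rewrite addrC exprDn; apply: eq_bigr => k _.
rewrite /binw !exprMn -mulr_natr; ring.
Qed.

Lemma binw_sum : \sum_(k < m.+1) binw k = 1.
Proof.
have := binw_mgf 1 1; rewrite !mulr1 addrC subrK expr1n => <-.
by apply: eq_bigr => k _; rewrite !expr1n !mulr1.
Qed.

Lemma binw_tail1 (sg g : R) : sg ^+ 2 = 1 -> 0 <= g ->
  \sum_(k < m.+1) binw k * (m%:R * g < sg * (k%:R - m%:R * zeta))%R%:R <=
  expR (- (2 * m%:R * g ^+ 2)).
Proof.
move=> sg1 g0; have /andP[z0 z1] := z01.
pose s := 4 * g * sg.
have e2 : s ^+ 2 = 16 * g ^+ 2 by rewrite /s exprMn sg1; ring.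
apply: (@le_trans _ _ (\sum_(k < m.+1) binw k *
   (expR (- (4 * m%:R * g ^+ 2)) * expR (s * (k%:R - m%:R * zeta))))).
  apply: ler_sum => k _; apply: ler_wpM2l; first exact: binw_ge0.
  case: (boolP (_ < _)%R) => h /=; last by rewrite mulr_ge0 ?expR_ge0.
  rewrite -expRD -[leLHS]expR0 ler_expR.
  rewrite [leRHS](_ : _ = 4 * g * (sg * (k%:R - m%:R * zeta) - m%:R * g)).
    by rewrite mulr_ge0// ?mulr_ge0// subr_ge0 ltW.
  by rewrite /s; ring.
have -> : \sum_(k < m.+1) binw k *
   (expR (- (4 * m%:R * g ^+ 2)) * expR (s * (k%:R - m%:R * zeta))) =
   expR (- (4 * m%:R * g ^+ 2)) *
   (zeta * expR (s * (1 - zeta)) + (1 - zeta) * expR (s * (0 - zeta))) ^+ m.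
  rewrite -binw_mgf mulr_sumr; apply: eq_bigr => k _; rewrite mulrCA; congr (_ * (_ * _)).
  rewrite -!expRM_natl -expRD; congr expR.
  have km : (k <= m)%N by rewrite -ltnS ltn_ord.
  by rewrite natrB//; ring.
apply: (@le_trans _ _ (expR (- (4 * m%:R * g ^+ 2)) * expR (s ^+ 2 / 8) ^+ m)).
  rewrite ler_wpM2l ?expR_ge0//; apply: lerXn2r; rewrite ?nnegrE ?expR_ge0//.
    by rewrite addr_ge0// mulr_ge0 ?expR_ge0 ?subr_ge0// ltW.
  by apply: hoeffding_lemma; rewrite !ltW.
rewrite -expRM_natl -expRD ler_expR e2; lra.
Qed.

Lemma binw_tail (g : R) :
  \sum_(k < m.+1) binw k * (m%:R * g < `|k%:R - m%:R * zeta|)%R%:R <=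
  4 * expR (- (2 * m%:R) * (Num.max 0 g) ^+ 2).
Proof.
have [g0|] := boolP (0 <= g); last first.
  rewrite -ltNge => /ltW g0; rewrite (max_idPl g0) expr0n mulr0 expR0 mulr1.
  apply: (@le_trans _ _ 1); last by rewrite ler1n.
  rewrite -[leRHS]binw_sum; apply: ler_sum => k _.
  by apply: ler_piMr; [exact: binw_ge0|case: (_ < _)%R].
rewrite (max_idPr g0).
have s1 : 1 ^+ 2 = 1 :> R by rewrite expr1n.
have sN1 : (- 1) ^+ 2 = 1 :> R by rewrite sqrrN expr1n.
have h1 := binw_tail1 s1 g0; have h2 := binw_tail1 sN1 g0.
rewrite mulNr; set X := expR _ in h1 h2 *.
have X0 : 0 <= X by exact: expR_ge0.
apply: (@le_trans _ _ (X + X)); last by lra.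
apply: le_trans (lerD h1 h2); rewrite -big_split/=; apply: ler_sum => k _.
rewrite -mulrDr; apply: ler_wpM2l; first exact: binw_ge0.
rewrite mul1r mulN1r ltr_normr.
by case: (_ < _)%R; case: (_ < _)%R => //=; rewrite ?addr0 ?add0r ?lerDl.
Qed.

Lemma binw_mean : (0 < m)%N -> \sum_(k < m.+1) binw k * (k%:R / m%:R) = zeta.
Proof.
move=> m0; have mn : m%:R != 0 :> R by rewrite pnatr_eq0 -lt0n.
rewrite big_ord_recl mul0r mulr0 add0r /binw.
case: m m0 mn => // n _ mn.
rewrite (eq_bigr (fun k : 'I_n.+1 => zeta * ((1 - zeta) ^+ (n - k) * zeta ^+ k *+ 'C(n, k)))).
  by rewrite -mulr_sumr -exprDn subrK expr1n mulr1.
move=> k _; rewrite lift0 subSS -[in RHS]mulr_natr exprS.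
have := mul_bin_diag n.+1 k; rewrite /= => /(congr1 (fun x => x%:R : R)); rewrite !natrM => e.
have -> : 'C(n.+1, k.+1)%:R * (zeta * zeta ^+ k) * (1 - zeta) ^+ (n - k) * (k.+1%:R / n.+1%:R)
  = (k.+1%:R * 'C(n.+1, k.+1)%:R) * (zeta * zeta ^+ k) * (1 - zeta) ^+ (n - k) / n.+1%:R by ring.
by rewrite -e; field.
Qed.

End Binomial.

Section Bridge.
Context {R : realType} (m lam : nat) (t : nat -> R).
Context (lm : (1 <= lam <= m)%N) (t0 : t 0%N = 0).
Context (t01 : forall k, (1 <= k <= m)%N -> 0 <= t k <= 1).
Context (tle : forall i j, (1 <= i)%N -> (i <= j)%N -> (j <= m)%N -> t i <= t j).
Context {d : measure_display} {T : measurableType d} (P : probability T R).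
Context (F : R -> R) (p : 'I_m -> T -> R).

Let fdpE m0 w : fdp m0 lam t (fun i => p i w) = fdpd m0 lam (cells p t w).
Proof. by apply: fdp_cell => // k /t01 /andP[]. Qed.

Let prod_fm2 m0 : \prod_(i < m) fm_cdf m0 F i 2 = 1 :> R.
Proof.
rewrite big1// => i _; rewrite /fm_cdf /cdf01.
have -> : (2 < 0 :> R) = false by rewrite ltNge ler0n.
have -> : (2 <= 1 :> R) = false by rewrite leNgt ltr1n.
by rewrite if_same.
Qed.

Lemma FDR_FM_discrete m0 : is_FM P m0 F p ->
  FDR_FM P m0 lam t p = (Ex (@wFM R m t m0 F) (fdpd m0 lam))%:E.
Proof.
move=> [mp H].
have H' x : P (setT `&` [set w | forall i, p i w <= x i]) =
    (1 * \prod_i fm_cdf m0 F i (x i))%:E by rewrite setTI mul1r H.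
have PO : P (inrange p) = 1%E by rewrite H prod_fm2.
rewrite /FDR_FM; under eq_integral do rewrite fdpE.
rewrite (@integral_fin _ _ _ P _ (cells p t) (fdpd m0 lam)); last 2 first.
- exact: measurable_cells.
- by move=> c; have /andP[] := @fdpd_bnd R _ _ lm m0 c.
rewrite /Ex -sumEFin; apply: eq_bigr => c _.
have mc := measurable_cells mp tle c.
rewrite -(full_setI mc (measurable_inrange mp) PO) setIC -[inrange p]setTI.
by rewrite (cell_prob mp t01 tle measurableT H') mul1r -EFinM mulrC.
Qed.

Lemma FDR_RM_discrete zeta M0 : 0 < zeta < 1 -> is_RM P zeta F M0 p ->
  FDR_RM P lam t M0 p =
  (\sum_(k < m.+1) binw m zeta k * Ex (@wFM R m t k F) (fdpd k lam))%:E.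
Proof.
move=> z01 [mp [mM H]].
have H' k x : P ([set w | M0 w = k] `&` [set w | forall i, p i w <= x i]) =
    (binw m zeta k * \prod_i fm_cdf k F i (x i))%:E by exact: H.
pose Ok k := [set w | M0 w = k] `&` inrange p.
have mOk k : measurable (Ok k) by apply: measurableI => //; exact: measurable_inrange.
pose O := \big[setU/set0]_(k < m.+1) Ok k.
have mO : measurable O by apply: bigsetU_measurable.
have PO : P O = 1%E.
  rewrite measure_bigsetU//.
    rewrite (eq_bigr (fun k : 'I_m.+1 => (binw m zeta k)%:E)); last first.
      by move=> k _; have := H' k (fun=> 2); rewrite /= prod_fm2 mulr1.
    by rewrite sumEFin binw_sum.
  by apply/trivIsetP => i j _ _ ij; apply/seteqP; split => // w /= [[e1 _] [e2 _]];
    move: ij; rewrite -e1 e2 eqxx.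
pose X w : 'I_m.+1 * {ffun 'I_m -> 'I_m.+1} := (inord (minn (M0 w) m), cells p t w).
pose h (x : 'I_m.+1 * {ffun 'I_m -> 'I_m.+1}) : R := fdpd x.1 lam x.2.
have minM w : (minn (M0 w) m < m.+1)%N by rewrite ltnS geq_minr.
have fE w : fdp (M0 w) lam t (fun i => p i w) = h (X w).
  rewrite fdpE /h /X/= inordK// /fdpd; apply: eq_bigl => i.
  by rewrite ltn_min ltn_ord andbT.
rewrite /FDR_RM; under eq_integral do rewrite fE.
have mX x : measurable [set w | X w = x].
  rewrite [Y in measurable Y](_ : _ =
    (\bigcup_(k in [set k | inord (minn k m) = x.1]) [set w | M0 w = k]) `&`
    [set w | cells p t w = x.2]).
    apply: measurableI; last exact: measurable_cells.
    exact: bigcup_measurable.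
  apply/seteqP; split => w /=.
    by move=> <-; split=> //; exists (M0 w).
  by move=> [[k /= e1 e2] e3]; rewrite /X e2 e1 e3 -surjective_pairing.
rewrite (@integral_fin _ _ _ P _ X h)//; last first.
  by move=> x; have /andP[] := @fdpd_bnd R _ _ lm x.1 x.2.
rewrite (eq_bigr (fun x : 'I_m.+1 * {ffun 'I_m -> 'I_m.+1} =>
   (binw m zeta x.1 * ((\prod_i wFM t x.1 F i (x.2 i)) * h x))%:E)).
  rewrite sumEFin; congr EFin.
  rewrite -(pair_bigA _ (fun (k : 'I_m.+1) (c : {ffun 'I_m -> 'I_m.+1}) =>
    binw m zeta k * ((\prod_i wFM t k F i (c i)) * h (k, c))))/=.
  by apply: eq_bigr => k _; rewrite -mulr_sumr.
move=> [k c] _ /=.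
rewrite -(full_setI (mX _) mO PO).
have -> : [set w | X w = (k, c)] `&` O = [set w | M0 w = k] `&` inrange p `&` [set w | cells p t w = c].
  apply/seteqP; split => w /=.
    move=> [[e1 e2]]; rewrite /O -bigcup_mkord => -[j /= jm [e3 rw]].
    have Mm : (M0 w <= m)%N by rewrite e3.
    split=> //; split=> //; move: e1 => /(congr1 val)/=; rewrite inordK//.
    by rewrite (minn_idPl Mm).
  move=> [[e1 rw] e2]; have km : (k <= m)%N by rewrite -ltnS ltn_ord.
  split; last by rewrite /O -bigcup_mkord; exists k.
  by rewrite /X e1 e2 (minn_idPl km) inord_val.
rewrite (cell_prob mp t01 tle (mM k) (H' k)) -EFinM; congr EFin; ring.
Qed.

End Bridge.

(** * The random mixture model *)

Section Random.
Context {R : realType} (rho : R -> R) (m lam : nat) (zeta delta : R).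
Context (m2 : (2 <= m)%N) (lm : (1 <= lam <= m)%N).
Context (r01 : forall x : R, 0 <= x <= 1 -> 0 <= rho x <= 1).
Context (rle : forall x y : R, 0 <= x -> x <= y -> y <= 1 -> rho x <= rho y).
Context (rst : forall x y : R, 0 < x -> x <= y -> y <= 1 -> rho x / x <= rho y / y).
Context (z0 : 0 < zeta) (z1 : zeta < 1) (d0 : 0 < delta) (d1 : delta < 1).
Context (F : R -> R).
Context (F01 : forall k, (1 <= k <= m)%N -> 0 <= F (thr rho m k) <= 1).
Context (Fle : forall j k, (1 <= j)%N -> (j <= k)%N -> (k <= m)%N ->
  F (thr rho m j) <= F (thr rho m k)).

Lemma FDRd_ge0 m0 G : (forall i, is_pmf (@wFM R m (thr rho m) m0 G i)) ->
  0 <= FDRd rho m lam m0 G.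
Proof.
move=> wP; rewrite -[leLHS](Ex_cst 0 wP); apply: Ex_le => [i a|c _].
  by case: (wP i).
by have /andP[] := @fdpd_bnd R _ _ lm m0 c.
Qed.

Lemma FDRd_le1 m0 G : (forall i, is_pmf (@wFM R m (thr rho m) m0 G i)) ->
  FDRd rho m lam m0 G <= 1.
Proof.
move=> wP; rewrite -[leRHS](Ex_cst 1 wP); apply: Ex_le => [i a|c _].
  by case: (wP i).
by have /andP[] := @fdpd_bnd R _ _ lm m0 c.
Qed.

Lemma random_term (gamma : R) (k : nat) : (k <= m)%N ->
  FDRd rho m lam k F <= FDRd rho m lam k (fun=> 1) +
    (k%:R / m%:R * eps_bound rho m lam zeta delta gamma +
     (m%:R * (gamma - 1 / m%:R) < `|k%:R - m%:R * zeta|)%R%:R).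
Proof.
move=> km.
have m0R : 0 < m%:R :> R by rewrite ltr0n; apply: leq_trans m2.
have wF := wFM_pmf m2 r01 rle rst k F01 Fle.
have w1 := wDU_pmf m2 r01 rle rst k.
have e0 : 0 <= k%:R / m%:R * eps_bound rho m lam zeta delta gamma.
  by rewrite mulr_ge0 ?divr_ge0// eps_ge0.
case: (boolP (_ < _)%R) => [_|] /=.
  by rewrite (le_trans (FDRd_le1 wF))// addrA lerDr addr_ge0// FDRd_ge0.
rewrite -leNgt addr0 => good.
have [k0|k0] := posnP k.
  have -> : FDRd rho m lam k F = 0 by rewrite FDRd_sum k0 big_pred0.
  by rewrite addr_ge0// FDRd_ge0.
have [kM|Mk] := ltnP k m; last first.
  have ek : k = m by apply/eqP; rewrite eqn_leq km.
  suff -> : FDRd rho m lam k F = FDRd rho m lam k (fun=> 1) by rewrite lerDl.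
  apply: eq_bigr => c _; congr (_ * _); apply: eq_bigr => i _.
  by rewrite /wFM ek ltn_ord.
have k0m : (0 < k < m)%N by rewrite k0.
apply: le_trans (fixed_discrete m2 lm r01 rle rst z0 z1 d0 d1 k0m F01 Fle) _.
rewrite lerD2l ler_wpM2l ?divr_ge0// eps_mono//.
have g1 : `|k%:R / m%:R - zeta| <= gamma - 1 / m%:R.
  have -> : k%:R / m%:R - zeta = (k%:R - m%:R * zeta) / m%:R.
    by field; rewrite gt_eqF.
  by rewrite normrM normfV (gtr0_norm m0R) ler_pdivrMr// [leRHS]mulrC.
have i0 : 0 <= 1 / m%:R :> R by rewrite divr_ge0.
rewrite ge_max; apply/andP; split; last by move: g1 i0; lra.
have -> : k.-1%:R / m%:R - zeta = (k%:R / m%:R - zeta) - 1 / m%:R :> R.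
  by rewrite -{2}(prednK k0) -natr1; ring.
apply: le_trans (ler_normB _ _) _; rewrite (ger0_norm i0); move: g1; lra.
Qed.

Lemma random_discrete (gamma : R) :
  \sum_(k < m.+1) binw m zeta k * FDRd rho m lam k F <=
  \sum_(k < m.+1) binw m zeta k * FDRd rho m lam k (fun=> 1) +
  (zeta * eps_bound rho m lam zeta delta gamma
     + 4 * expR (- (2 * m%:R) * (Num.max 0 (gamma - 1 / m%:R)) ^+ 2)).
Proof.
have z01 : 0 < zeta < 1 by rewrite z0 z1.
have mp : (0 < m)%N by apply: leq_trans m2.
apply: (@le_trans _ _ (\sum_(k < m.+1) binw m zeta k * (FDRd rho m lam k (fun=> 1) +
    (k%:R / m%:R * eps_bound rho m lam zeta delta gamma +
     (m%:R * (gamma - 1 / m%:R) < `|k%:R - m%:R * zeta|)%R%:R)))).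
  apply: ler_sum => k _; apply: ler_wpM2l; first exact: binw_ge0.
  by apply: random_term; rewrite -ltnS ltn_ord.
set e := eps_bound _ _ _ _ _ _.
rewrite -[X in _ <= _ + (X * e + _)](binw_mean zeta mp) mulr_suml.
under eq_bigr => k _ do rewrite mulrDr (mulrDr _ _ (_%:R)) (mulrA _ _ e).
by rewrite !big_split/= lerD2l lerD2l; exact: binw_tail.
Qed.

End Random.

Theorem theorem4p2 (R : realType) (m : nat) (rho : R -> R) (zeta : R)
    (lam : nat) (delta : R) :
  (2 <= m)%N ->
  {within [set x | 0 <= x <= 1], continuous rho} ->
  (forall x, 0 <= x <= 1 -> 0 <= rho x <= 1) ->
  (forall x y, 0 <= x -> x <= y -> y <= 1 -> rho x <= rho y) ->
  (forall x y, 0 < x -> x <= y -> y <= 1 -> rho x / x <= rho y / y) ->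
  0 < zeta < 1 -> (1 <= lam <= m)%N -> 0 < delta < 1 ->
  forall F : R -> R, in_calF F ->
  (forall m0 : nat, (0 < m0 < m)%N ->
     let nu := Num.max `|m0.-1%:R / m%:R - zeta| `|m0%:R / m%:R - zeta| in
     forall (d1 : measure_display) (T1 : measurableType d1)
            (P1 : probability T1 R) (p : 'I_m -> T1 -> R)
            (d2 : measure_display) (T2 : measurableType d2)
            (P2 : probability T2 R) (q : 'I_m -> T2 -> R),
     is_FM P1 m0 F p -> is_FM P2 m0 (fun _ => 1) q ->
     (FDR_FM P1 m0 lam (thr rho m) p <=
      FDR_FM P2 m0 lam (thr rho m) q +
      (m0%:R / m%:R * eps_bound rho m lam zeta delta nu)%:E)%E)
  /\
  (forall gamma : R, 0 < gamma < 1 ->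
     forall (d1 : measure_display) (T1 : measurableType d1)
            (P1 : probability T1 R) (M0 : T1 -> nat) (p : 'I_m -> T1 -> R)
            (d2 : measure_display) (T2 : measurableType d2)
            (P2 : probability T2 R) (N0 : T2 -> nat) (q : 'I_m -> T2 -> R),
     is_RM P1 zeta F M0 p -> is_RM P2 zeta (fun _ => 1) N0 q ->
     (FDR_RM P1 lam (thr rho m) M0 p <=
      FDR_RM P2 lam (thr rho m) N0 q +
      (zeta * eps_bound rho m lam zeta delta gamma
       + 4 * expR (- (2 * m%:R) * (Num.max 0 (gamma - 1 / m%:R)) ^+ 2))%:E)%E).
Proof.
move=> m2 _ r01 rle rst z01 lm d01 F [_ [F01 [Fle _]]].
have /andP[z0 z1] := z01; have /andP[d0 d1] := d01.
have t01 k : (1 <= k <= m)%N -> 0 <= thr rho m k <= 1.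
  by move=> /andP[_ km]; exact: (thr01 m2 r01 rle rst km).
have tle i j : (1 <= i)%N -> (i <= j)%N -> (j <= m)%N -> thr rho m i <= thr rho m j.
  by move=> _ ij jm; exact: (thr_le m2 r01 rle rst ij jm).
have F01' k : (1 <= k <= m)%N -> 0 <= F (thr rho m k) <= 1.
  by move=> /t01; exact: F01.
have Fle' j k : (1 <= j)%N -> (j <= k)%N -> (k <= m)%N -> F (thr rho m j) <= F (thr rho m k).
  move=> j1 jk km; have jm : (1 <= j <= m)%N by rewrite j1 (leq_trans jk).
  have k1 : (1 <= k <= m)%N by rewrite km (leq_trans j1).
  apply: Fle; [by case/andP: (t01 _ jm)|exact: tle|by case/andP: (t01 _ k1)].
split.
- move=> m0 m0m nu dd1 T1 P1 p dd2 T2 P2 q pF q1.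
  rewrite (FDR_FM_discrete lm erefl t01 tle pF) (FDR_FM_discrete lm erefl t01 tle q1).
  rewrite -EFinD lee_fin.
  exact: (fixed_discrete m2 lm r01 rle rst z0 z1 d0 d1 m0m F01' Fle').
- move=> gamma _ dd1 T1 P1 M0 p dd2 T2 P2 N0 q pF q1.
  rewrite (FDR_RM_discrete lm erefl t01 tle z01 pF).
  rewrite (FDR_RM_discrete lm erefl t01 tle z01 q1) -EFinD lee_fin.
  exact: random_discrete.
Qed.
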